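(* Let $\kappa$ be an infinite cardinal and let $\vec{p}$ be a sequence of integers greater than $1$. If $\Lambda$ is the closed long line of length $\omega_1\cdot\omega^\kappa$ (ordinal arithmetic), then $S(\Lambda,\vec{p})$ is $\frac1\kappa$-homogeneous. In particular, with $\Lambda$ the closed long line of length $\omega_1\cdot\omega^\omega$, the continuum $S(\Lambda,\vec p)$ is $\frac1\omega$-homogeneous; with $\Lambda$ the closed long line of length $\omega_1^2$ it is $\frac1{\omega_1}$-homogeneous; and for $\kappa\ge\omega_2$, with $\Lambda$ the closed long line of length $\kappa$ it is $\frac1\kappa$-homogeneous.
   Context: For a cardinal $\kappa\ge 1$, a space $Y$ is $\frac1\kappa$-homogeneous if the action of its homeomorphism group $\operatorname{Homeo}(Y)$ on $Y$ has exactly $\kappa$ orbits. For an ordinal $\delta$, the long line of length $\delta$, denoted $[0,\delta)$, is obtained by putting a copy of the open unit interval $(0,1)$ between $\alpha$ and $\alpha+1$ for each $\alpha\in\delta$, with the natural order topology; the closed long line of length $\delta$, denoted $[0,\delta]$, adds $\delta$ as a last (compactifying) point. All products and powers of ordinals are ordinal arithmetic: $\alpha\cdot\beta$ is the order type of $\beta\times\alpha$ with the lexicographic order ($\alpha$ laid end to end $\beta$ times); $\gamma^0=1$, $\gamma^{\beta+1}=\gamma^\beta\cdot\gamma$, and $\gamma^\alpha=\sup\{\gamma^\beta:\beta<\alpha\}$ for limit $\alpha$. Cardinals are identified with initial ordinals. An ordered continuum is a nondegenerate compact connected space $\Lambda$ which has a linear order and whose topology is the order topology; $\partial\Lambda$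 is the set consisting of its first and last points. For $n\ge 1$, $\Lambda^{(n)}=\Lambda_1\vee\dots\vee\Lambda_n$ denotes $n$ copies of $\Lambda$ laid end to end (the last point of $\Lambda_i$ is identified with the first point of $\Lambda_{i+1}$, orders preserved), and $\Sigma^{(n)}=\Lambda^{(n)}/\partial\Lambda^{(n)}$ is the ''circle'' obtained by identifying the first and last points of $\Lambda^{(n)}$; $\Sigma=\Sigma^{(1)}$. The identified endpoints of the copies of $\Lambda$ in $\Sigma^{(n)}$ are labeled in cyclic order $\infty_0,\dots,\infty_{n-1}$, and for $x\in\Lambda\setminus\partial\Lambda$, $\infty_i+x$ denotes the copy of $x$ in the $i$th copy of $\Lambda$ (the one starting at $\infty_i$). For positive integers $m,n$ the $m$-fold covering map $\phi^m_n:\Sigma^{(mn)}\to\Sigma^{(n)}$ is given by $\phi^m_n(\infty_i)=\infty_j$ and $\phi^m_n(\infty_i+x)=\infty_j+x$, where $j=i \bmod n$. For a sequence $\vec{p}=\langle p_1,p_2,\dots\rangle$ of positive integers, put $k(1)=1$ and $k(n)=p_1p_2\cdots p_{n-1}$ for $n>1$, and let $S(\Lambda,\vec{p})=\varprojlim\{\phi^{p_n}_{k(n)},\Sigma^{(k(n))},n\in\mathbb{N}\}$, the inverse limit with bonding maps $\phi^{p_n}_{k(n)}:\Sigma^{(k(n+1))}\to\Sigma^{(k(n))}$. *)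

(* Defs.v *)
From HB Require Import structures.
From mathcomp Require Import all_boot all_order all_algebra.
From mathcomp Require Import all_classical all_reals all_analysis.
From mathcomp Require Import wochoice.

Set Implicit Arguments.
Unset Strict Implicit.
Unset Printing Implicit Defensive.
Import Order.TTheory GRing.Theory Num.Theory.

Local Open Scope classical_set_scope.
Local Open Scope card_scope.
Local Open Scope order_scope.

(** Ordinals are represented by well-ordered types, and are only meant up to
    isomorphism. *)

Record ord := Ord {
  ord_disp : Order.disp_t;
  ord_sort :> orderType ord_disp;
  ord_wo : well_order (<=%O : rel ord_sort) }.

Lemma well_order_of_wf d (T : orderType d) :
  well_founded (<%O : rel T) -> well_order (<=%O : rel T).
Proof.
move=> wfT; apply: antisymmetric_well_order; first exact: le_anti.
move=> A [x]; elim/(well_founded_ind wfT): x => x IH Ax.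
have [[y [Ay yx]]|nA] := pselect (exists y, y \in A /\ y < x); first exact: IH Ay.
exists x; split=> // y Ay; rewrite leNgt; apply/negP => yx.
by apply: nA; exists y.
Qed.

Lemma ord_wf (A : ord) : well_founded (<%O : rel A).
Proof.
move=> a; apply: contrapT => nAcc.
have [|z [[zN zmin] _]] := @ord_wo A [pred x | `[< ~ Acc <%O x >]].
  by exists a; apply/asboolP.
move/asboolP: zN; apply; constructor => y yz; apply: contrapT => ny.
have /zmin : y \in [pred x | `[< ~ Acc <%O x >]] by apply/asboolP.
by rewrite leNgt yz.
Qed.

Lemma wf_nat : well_founded (<%O : rel nat).
Proof. by move=> n; elim/ltn_ind: n => n IH; constructor => m; exact: IH. Qed.

Lemma wf_homo d d' (T : orderType d) (U : orderType d') (f : T -> U) :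
  {homo f : x y / x < y} -> well_founded (<%O : rel U) ->
  well_founded (<%O : rel T).
Proof.
move=> fh wfU x; move: {2}(f x) (erefl (f x)) => u.
elim/(well_founded_ind wfU): u x => u IH x fxu.
by constructor => y yx; apply: (IH (f y)) => //; rewrite -fxu; exact: fh.
Qed.

Definition omega : ord := Ord (well_order_of_wf wf_nat).

Lemma wf_fin n : well_founded (<%O : rel 'I_n).
Proof. by apply: (@wf_homo _ _ _ nat (@nat_of_ord n)) wf_nat => i j. Qed.

Definition fin_ord (n : nat) : ord := Ord (well_order_of_wf (@wf_fin n)).

Section sub_ord.
Context d (T : orderType d) (P : {pred T}).
Definition sub_order : Type := {x : T | x \in P}.
HB.instance Definition _ := SubChoice.on sub_order.
HB.instance Definition _ := [SubChoice_isSubOrder of sub_order by <: with d].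
End sub_ord.

Lemma wf_sub d (T : orderType d) (P : {pred T}) :
  well_founded (<%O : rel T) -> well_founded (<%O : rel (sub_order P)).
Proof.
by move=> wfT; apply: (@wf_homo _ _ (sub_order P) T val) wfT => i j; rewrite lt_val.
Qed.

Definition sub_ord (A : ord) (P : {pred A}) : ord :=
  Ord (well_order_of_wf (wf_sub (P := P) (@ord_wf A))).

Lemma sub_ord_leE (A : ord) (P : {pred A}) (x y : sub_ord P) :
  (x <= y) = (val x <= val y).
Proof. by rewrite Order.le_val. Qed.

(** The ordinal [a] when the elements of [A] are viewed as ordinals less than
    [A]. *)
Definition segment (A : ord) (a : A) : ord := sub_ord [pred x : A | x < a].

Definition initial_embedding (A B : ord) (f : A -> B) :=
  {mono f : x y / x <= y} /\ (forall a b, b <= f a -> exists a', f a' = b).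

Definition ord_le (A B : ord) := exists f : A -> B, initial_embedding f.

Definition is_sup (I : Type) (F : I -> ord) (W : ord) :=
  (forall i, ord_le (F i) W) /\
  (forall W', (forall i, ord_le (F i) W') -> ord_le W W').

(** [W] is the least ordinal of cardinality not at most that of [A]. *)
Definition is_next_cardinal (A W : ord) :=
  ~ ([set: W] #<= [set: A]) /\
  (forall w : W, [set x | x < w] #<= [set: A]).

Lemma wo_type (T : Type) : exists W : ord, exists f : T -> W, bijective f.
Proof.
pose U := {classic T}; have [R Rwo] := well_ordering_principle U.
have Rtot : total R by move=> x y; exact: (wo_chainW (withinW Rwo)).
have [Rr Rmin] : reflexive R /\ (forall A : {pred U}, nonempty A ->
   exists! z, minimum_of R A z) by split => // x; have := Rtot x x; rewrite orbb.
have Ranti : antisymmetric R.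
  move=> x y /andP[xy yx].
  have [|z [_ zu]] := Rmin [pred u | (u == x) || (u == y)].
    by exists x; rewrite inE eqxx.
  rewrite -(zu x); last first.
    split; first by rewrite inE eqxx.
    by move=> u; rewrite inE => /orP[] /eqP ->; rewrite ?Rr.
  apply: zu; split; first by rewrite inE eqxx orbT.
  by move=> u; rewrite inE => /orP[] /eqP ->; rewrite ?Rr.
have Rtrans : transitive R.
  move=> y x z xy yz.
  have [|t [[tin tlb] tu]] := Rmin [pred u | [|| u == x, u == y | u == z]].
    by exists x; rewrite inE eqxx.
  have [xin yin zin] : [/\ R t x, R t y & R t z].
    by split; apply: tlb; rewrite inE eqxx ?orbT.
  move: tin; rewrite inE => /or3P[] /eqP E; subst t => //.
    by rewrite (Ranti x y) // xy xin.
  have yzE : y = z by apply: Ranti; rewrite yz yin.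
  by subst z.
pose lt x y := (y != x) && R x y.
pose m := Order.Le_isPOrder.Build Order.default_display U Rr Ranti Rtrans.
pose P : porderType _ := HB.pack U m.
pose t := Order.POrder_isTotal.Build Order.default_display P Rtot.
pose O : orderType Order.default_display := HB.pack U P t.
by exists (@Ord _ O Rwo), id; exists id.
Qed.

Lemma inj_cardT (T U : Type) (f : T -> U) :
  injective f -> [set: T] #<= [set: U].
Proof.
move=> finj; apply: (@card_le_trans _ _ _ (f @` [set: T])); last first.
  exact: subset_card_le.
have /card_eqPle[//] : [set: T] #= f @` [set: T].
by rewrite card_eq_sym; apply: inj_card_eq => x y _ _; exact: finj.
Qed.

Lemma cantor (T : Type) : ~ ([set: set T] #<= [set: T]).
Proof.
move=> /pcard_surjP[f fsurj]; have [x _ fx] := fsurj [set y | ~ f y y] I.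
have nfx : ~ f x x by move=> fxx; have := fxx; rewrite {1}fx; exact.
by apply: (nfx); rewrite fx.
Qed.

Lemma initial_embedding_exists (A W : ord) :
  ~ ([set: W] #<= [set: A]) -> ord_le A W.
Proof.
move=> nWA.
have [w0 _] : [set: W] !=set0.
  by apply/set0P/negP => /eqP W0; apply: nWA; rewrite W0 card_ge0.
pose step (x : A) (r : forall y, y < x -> W) : W :=
  xget w0 [set w | (forall y (yx : y < x), r y yx <> w) /\
                   forall v, (forall y (yx : y < x), r y yx <> v) -> w <= v].
pose f := Fix (@ord_wf A) (fun _ => W) step.
have fE x : f x = step x (fun y _ => f y).
  rewrite /f Fix_eq // => {}x r r' rr'.
  by congr step; apply: functional_extensionality_dep => y; apply/funext => yx.
have fP x : (forall y, y < x -> f y <> f x) /\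
    (forall v, (forall y, y < x -> f y <> v) -> f x <= v).
  suff : [set w | (forall y, y < x -> f y <> w) /\
      forall v, (forall y, y < x -> f y <> v) -> w <= v] (f x) by [].
  rewrite [f x]fE; apply: xgetPex.
  have [v vP] : exists v, forall y, y < x -> f y <> v.
    apply: contrapT => /forallNP nv; apply: nWA.
    apply: (card_le_trans _ (card_leT [set y | y < x])).
    apply: (card_le_trans _ (card_image_le f _)).
    apply: subset_card_le => w _; apply: contrapT => nw; apply: (nv w) => y yx fy.
    by apply: nw; exists y.
  have [|z [[zN zmin] _]] :=
      @ord_wo W [pred v | `[< forall y, y < x -> f y <> v >]].
    by exists v; apply/asboolP.
  exists z; split; first exact/asboolP.
  by move=> u uP; apply: zmin; apply/asboolP.
have flt x y : x < y -> f x < f y.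
  move=> xy; have [ny ymin] := fP y; have [nx xmin] := fP x.
  rewrite lt_neqAle; apply/andP; split; first exact/eqP/ny.
  by apply: xmin => z zx; apply: ny; exact: lt_trans xy.
exists f; split; first exact: le_mono.
move=> a b ba; apply: contrapT => /forallNP nb.
have : f a <= b by apply: (proj2 (fP a)) => y _; exact: nb.
by move=> ab; apply: (nb a); apply/eqP; rewrite eq_le ab ba.
Qed.

Lemma initial_embedding_transfer (A B W W' : ord) (f : A -> W) (f' : B -> W)
    (g : A -> W') (g' : B -> W') :
  initial_embedding f -> initial_embedding f' ->
  initial_embedding g -> initial_embedding g' ->
  forall a b, f a <= f' b -> g a <= g' b.
Proof.
move=> [fm fi] [f'm f'i] [gm gi] [g'm g'i] a.
elim/(well_founded_ind (@ord_wf A)): a => a IH b fab.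
rewrite leNgt; apply/negP => lt_g.
have [a' a'b] := gi _ _ (ltW lt_g).
have a'a : a' < a by rewrite -(leW_mono gm) a'b.
have lt_f : f a' < f' b by rewrite (lt_le_trans _ fab) // (leW_mono fm).
have [b' b'a'] := f'i _ _ (ltW lt_f).
have b'b : b' < b by rewrite -(leW_mono f'm) b'a'.
have : g a' <= g' b' by apply: IH => //; rewrite b'a'.
by rewrite a'b leNgt (leW_mono g'm) b'b.
Qed.


Lemma is_sup_exists (I : Type) (F : I -> ord) : exists W, is_sup F W.
Proof.
pose S := {i : I & F i}.
have [W0 [b bij_b]] := wo_type (set S).
have fex i : exists f : F i -> W0, initial_embedding f.
  apply: initial_embedding_exists => W0F; apply: (@cantor S).
  apply: (card_le_trans (inj_cardT (bij_inj bij_b))).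
  apply: (card_le_trans W0F); apply: (@inj_cardT _ _ (existT _ i)).
  move=> x y; elim/Pchoice: I F S {W0 b bij_b W0F} i x y => I F S i x y.
  exact: existT_inj2.
pose f i := sval (cid (fex i)).
have fP i : initial_embedding (f i) := svalP (cid (fex i)).
pose P : {pred W0} := [pred w | `[< exists i x, f i x = w >]].
have fin i x : f i x \in P by apply/asboolP; exists i, x.
exists (sub_ord P); split=> [i|W' gex].
  exists (fun x => exist _ (f i x) (fin i x) : sub_ord P); split.
    by move=> x y; rewrite sub_ord_leE /=; exact: (proj1 (fP i)).
  move=> x [w wP] /=; rewrite sub_ord_leE /= => wx.
  have [y yw] := proj2 (fP i) _ _ wx; exists y.
  exact: val_inj.
pose g i := sval (cid (gex i)).
have gP i : initial_embedding (g i) := svalP (cid (gex i)).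
have /choice[h hP] : forall w : sub_ord P, exists w', exists i x,
    f i x = val w /\ g i x = w'.
  by move=> [w /[dup] /asboolP[i [x fx]] wP]; exists (g i x), i, x.
have tr i j x y : (g i x <= g j y) = (f i x <= f j y).
  by apply/idP/idP; exact: initial_embedding_transfer.
exists h; split.
  move=> v w; have [i [x [fx <-]]] := hP v; have [j [y [fy <-]]] := hP w.
  by rewrite tr fx fy sub_ord_leE.
move=> v w'; have [i [x [fx <-]]] := hP v => /(proj2 (gP i))[y <-].
exists (exist _ (f i y) (fin i y)).
have [j [z [fz <-]]] := hP (exist _ (f i y) (fin i y)).
by apply/eqP; rewrite eq_le !tr fz /= lexx.
Qed.

Lemma is_next_cardinal_exists (A : ord) : exists W, is_next_cardinal A W.
Proof.
have [W0 [b bij_b]] := wo_type (set A).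
have W0A : ~ ([set: W0] #<= [set: A]).
  by move=> /(card_le_trans (inj_cardT (bij_inj bij_b)))/cantor.
have [[w0 w0P]|/forallNP nex] :=
    pselect (exists w : W0, ~ ([set x | x < w] #<= [set: A])); last first.
  by exists W0; split => // w; apply: contrapT => /nex.
have [|w [[wN wmin] _]] :=
    @ord_wo W0 [pred w | `[< ~ ([set x | x < w] #<= [set: A]) >]].
  by exists w0; apply/asboolP.
exists (segment w); split=> [|[v vw]].
  move=> wA; move/asboolP: wN; apply; apply: card_le_trans wA.
  rewrite (_ : [set x | _] = val @` [set: segment w]) ?card_image_le //.
  apply/seteqP; split=> [x xw|_ [[x xw] _ <-]] //=.
  by exists (exist _ x xw : segment w).
apply: contrapT => nA.
have : v \in [pred w | `[< ~ ([set x : W0 | x < w] #<= [set: A]) >]].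
  apply/asboolP => vA; apply: nA; apply: card_le_trans vA.
  apply: (@card_le_trans _ _ _ (val @` [set x : segment w | x < exist _ v vw])).
    have /card_eqPle[//] : [set x : segment w | x < exist _ v vw] #=
        val @` [set x : segment w | x < exist _ v vw].
      by rewrite card_eq_sym; apply: inj_card_eq => x y _ _; exact: val_inj.
  by apply: subset_card_le => _ [x xv <-]; rewrite /= -lt_val in xv.
by move/wmin; rewrite leNgt => /negP; apply; exact: vw.
Qed.

Definition ord_sup (I : Type) (F : I -> ord) : ord := sval (cid (is_sup_exists F)).

Definition next_cardinal (A : ord) : ord := sval (cid (is_next_cardinal_exists A)).

Definition omega1 : ord := next_cardinal omega.
Definition omega2 : ord := next_cardinal omega1.

Lemma wf_lexi d d' (T : orderType d) (U : orderType d') :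
  well_founded (<%O : rel T) -> well_founded (<%O : rel U) ->
  well_founded (<%O : rel (T *l U)).
Proof.
move=> wfT wfU [x]; elim/(well_founded_ind wfT): x => x IHx y.
elim/(well_founded_ind wfU): y => y IHy; constructor => -[x' y'].
rewrite ltEprodlexi /= => /andP[]; rewrite le_eqVlt => /predU1P[->|x'x _].
  by rewrite lexx /=; exact: IHy.
exact: IHx.
Qed.

(** [A] laid end to end [B] times: the lexicographic order on [B * A]. *)
Definition ord_mul (A B : ord) : ord :=
  Ord (well_order_of_wf (wf_lexi (@ord_wf B) (@ord_wf A))).

(** One step of the recursion defining the power with base [g]: [E b] stands
    for the power whose exponent is the ordinal [b]. *)
Definition exp_step (g A : ord) (E : A -> ord) : ord :=
  if pselect (A -> False) then fin_ord 1 else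
  match pselect (exists b : A, forall a, a <= b) with
  | left maxA => ord_mul (E (sval (cid maxA))) g
  | right _ => ord_sup E
  end.

Definition ord_exp_at (g A : ord) : A -> ord :=
  Fix (@ord_wf A) (fun _ => ord)
    (fun a E => exp_step g (fun b : segment a => E (val b) (valP b))).

Lemma ord_exp_atE (g A : ord) (a : A) :
  ord_exp_at g a = exp_step g (fun b : segment a => ord_exp_at g (val b)).
Proof.
rewrite /ord_exp_at Fix_eq // => {}a E E' EE'; congr exp_step.
by apply: functional_extensionality_dep => b; exact: EE'.
Qed.

Definition ord_exp (g A : ord) : ord := exp_step g (@ord_exp_at g A).

(** Cardinals are initial ordinals. *)
Definition is_cardinal (A : ord) :=
  forall a : A, ~ ([set x | x < a] #= [set: A]).

Definition is_infinite_cardinal (A : ord) :=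
  is_cardinal A /\ infinite_set [set: A].

Section unit_co.
Context (R : realType).
Definition unit_co : Type := {t : R | 0 <= t < 1}%R.
HB.instance Definition _ := SubChoice.on unit_co.
HB.instance Definition _ := [SubChoice_isSubOrder of unit_co by <: with ring_display].
End unit_co.

(** [None] is a last point added to [T]. *)
Section add_last.
Context d (T : orderType d).
Definition add_last : Type := option T.
HB.instance Definition _ := Choice.on add_last.

Definition add_last_le (x y : add_last) : bool :=
  match x, y with
  | _, None => true
  | None, Some _ => false
  | Some a, Some b => a <= b
  end.

Lemma add_last_le_refl : reflexive add_last_le.
Proof. by case=> /=. Qed.

Lemma add_last_le_anti : antisymmetric add_last_le.
Proof. by move=> [x|] [y|] //= /le_anti ->. Qed.

Lemma add_last_le_trans : transitive add_last_le.
Proof. by move=> [x|] [y|] [z|] //=; exact: le_trans. Qed.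

Lemma add_last_le_total : total add_last_le.
Proof. by move=> [x|] [y|] //=; exact: le_total. Qed.

HB.instance Definition _ := Order.Le_isPOrder.Build d add_last
  add_last_le_refl add_last_le_anti add_last_le_trans.
HB.instance Definition _ := Order.POrder_isTotal.Build d add_last add_last_le_total.
End add_last.

(** The point [(a, t)] of the lexicographic product is the ordinal [a] if
    [t = 0], and otherwise lies in the copy of the open unit interval between
    [a] and [a + 1]. *)
Definition closed_long_line (R : realType) (A : ord) :=
  order_topology (add_last (A *l unit_co R)).

Section identification.
Local Open Scope quotient_scope.
Context (X : topologicalType) (r : X -> X -> Prop).

Inductive glued : X -> X -> Prop :=
| glued_step x y : r x y -> glued x y
| glued_refl x : glued x x
| glued_sym x y : glued x y -> glued y x
| glued_trans x y z : glued x y -> glued y z -> glued x z.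

Definition gluedb (x y : X) : bool := `[< glued x y >].

Lemma gluedb_refl : reflexive gluedb.
Proof. by move=> x; apply/asboolP; exact: glued_refl. Qed.

Lemma gluedb_sym : symmetric gluedb.
Proof. by move=> x y; apply/asboolP/asboolP; exact: glued_sym. Qed.

Lemma gluedb_trans : transitive gluedb.
Proof.
move=> y x z /asboolP xy /asboolP yz; apply/asboolP; exact: glued_trans yz.
Qed.

Definition glued_equiv := EquivRel gluedb gluedb_refl gluedb_sym gluedb_trans.

Definition identification := quotient_topology {eq_quot glued_equiv}.
HB.instance Definition _ := Topological.on identification.
HB.instance Definition _ := Quotient.on identification.

Lemma identificationP (x y : X) :
  \pi_identification x = \pi_identification y <-> glued x y.
Proof.
split=> [xy|xy]; last exact/eqmodP/asboolP.
suff : gluedb x y by move/asboolP.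
by have /eqmodP : x = y %[mod {eq_quot glued_equiv}] := xy.
Qed.
End identification.

Definition is_first d (T : porderType d) (x : T) := forall y : T, x <= y.
Definition is_last d (T : porderType d) (x : T) := forall y : T, y <= x.

Section solenoid.
Context d (L : orderTopologicalType d).
Local Open Scope quotient_scope.

Local Notation copies n := {i : 'I_n & L}.

(** [chain n] is L^(n): the last point of each copy is identified with the
    first point of the next one. *)
Definition chain_rel n (u v : copies n) :=
  [/\ tag v = (tag u).+1 :> nat, is_last (tagged u) & is_first (tagged v)].
Definition chain n := identification (@chain_rel n).

(** [circle n] is Sigma^(n): the first point of L^(n) is identified with its
    last point. *)
Definition circle_rel n (x y : chain n) :=
  exists u v : copies n,
    [/\ x = \pi u, tag u = 0 :> nat & is_first (tagged u)] /\
    [/\ y = \pi v, (tag v).+1 = n & is_last (tagged v)].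
Definition circle n := identification (@circle_rel n).

Definition circle_pt n (i : 'I_n) (x : L) : circle n :=
  \pi_(circle n) (\pi_(chain n) (existT _ i x)).

Lemma modn_ord m n (i : 'I_(m * n)) : (i %% n < n)%N.
Proof.
by rewrite ltn_mod; case: n i => [|//] i; case: i => i /=; rewrite muln0.
Qed.

(** The m-fold covering map, read off a representative [(i, x)] with [x] in the
    i-th copy of [L]; [circle_coverE] shows that the choice is irrelevant. *)
Definition circle_cover m n (z : circle (m * n)) : circle n :=
  let u := repr (repr z : chain (m * n)) in
  circle_pt (Ordinal (modn_ord (tag u))) (tagged u).

Lemma circle_coverE m n (i : 'I_(m * n)) (x : L) :
  circle_cover (circle_pt i x) = circle_pt (Ordinal (modn_ord i)) x.
Proof.
have n0 : (0 < n)%N by exact: leq_ltn_trans (modn_ord i).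
pose c (u : copies (m * n)) := circle_pt (Ordinal (modn_ord (tag u))) (tagged u).
have wrap (u v : copies n) : tag u = 0 :> nat -> is_first (tagged u) ->
    (tag v).+1 = n -> is_last (tagged v) ->
    circle_pt (tag u) (tagged u) = circle_pt (tag v) (tagged v).
  move=> u0 uf vn vl; apply/identificationP/glued_step.
  by exists u, v; case: u v {u0 uf vn vl} (u0) (uf) (vn) (vl) => [? ?] [? ?].
have chainP (u v : copies (m * n)) : glued (@chain_rel _) u v -> c u = c v.
  elim=> {u v} [u v [uv ul vf]|//|//|u v w _ -> _ ->//].
  rewrite /c; have [un|un] := eqVneq (tag u %% n).+1 n.
    apply/esym; apply: (wrap (existT _ _ _) (existT _ _ _)) => //=.
    by rewrite uv -addn1 -modnDml addn1 un modnn.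
  congr (\pi_(circle n) _); apply/identificationP/glued_step; split => //=.
  rewrite uv -addn1 -modnDml addn1 modn_small //.
  by rewrite ltn_neqAle un ltn_mod.
have reprP (y : chain (m * n)) u : y = \pi u -> c (repr y) = c u.
  by move=> yu; apply/chainP/identificationP; rewrite reprK.
have circleP (y z : chain (m * n)) :
    glued (@circle_rel _) y z -> c (repr y) = c (repr z).
  elim=> {y z} [y z [u [v [[yu u0 uf] [zv vn vl]]]]|//|//|u v w _ -> _ ->//].
  rewrite (reprP _ _ yu) (reprP _ _ zv).
  apply: (wrap (existT _ _ _) (existT _ _ _)) => //=; first by rewrite u0 mod0n.
  have [//|un] := eqVneq (tag v %% n).+1 n.
  have : ((tag v).+1 %% n)%N = 0 by rewrite vn modnMl.
  by rewrite -addn1 -modnDml addn1 modn_small // ltn_neqAle un ltn_mod.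
have -> : circle_cover (circle_pt i x) = c (repr (repr (circle_pt i x))) by [].
rewrite (circleP _ (\pi_(chain (m * n)) (existT _ i x))); last first.
  by apply/identificationP; rewrite reprK.
exact: (reprP _ (existT _ i x) erefl).
Qed.

(** [degree p n] is k(n + 1) and [p n] is p_(n+1): indices start at 0 here and
    at 1 in the usual notation. *)
Fixpoint degree (p : nat -> nat) (n : nat) : nat :=
  if n is n'.+1 then (p n' * degree p n')%N else 1%N.

Definition solenoid (p : nat -> nat) : topologicalType :=
  [set s : prod_topology (fun n => circle (degree p n)) |
     forall n, circle_cover (s n.+1) = s n].
End solenoid.

Definition homeomorphism (X : topologicalType) (h : X -> X) :=
  continuous h /\ exists g : X -> X, [/\ continuous g, cancel h g & cancel g h].

Definition homeo_orbit (X : topologicalType) (x : X) : set X :=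
  [set y | exists2 h : X -> X, homeomorphism h & h x = y].

(** [X] is 1/k-homogeneous, for a cardinal [k]: its homeomorphism group has
    exactly [k] orbits. *)
Definition frac_homogeneous (k : ord) (X : topologicalType) :=
  [set homeo_orbit x | x in [set: X]] #= [set: k].

(* Main.v *)
From HB Require Import structures.
Require Import Defs.
From mathcomp Require Import all_boot all_order all_algebra.
From mathcomp Require Import all_classical all_reals all_analysis.
From mathcomp Require Import ring lra.

Set Implicit Arguments.
Unset Strict Implicit.
Unset Printing Implicit Defensive.
Import Order.TTheory GRing.Theory Num.Theory.

Local Open Scope classical_set_scope.
Local Open Scope card_scope.
Local Open Scope order_scope.

(** The solenoid of [L] is locally a product of an arc of [L] and a Cantor set,
    and its points over a point of [L] lie in one orbit, because the inverse
    limit of the cyclic groups of order [degree p n] acts by translations and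
    is transitive on each fibre. Automorphisms of [L] act too
    ([thread_orbit]), so the orbits of the solenoid are at most as many as the
    orbits of the automorphisms of [L] on its points other than the last one.

    Let [L] have length [omega1 * W], and cut it into [W] blocks of length
    [omega1]. An initial part of a block is the long line over a countable
    ordinal, which is an arc: giving summable lengths to its unit intervals
    identifies it with a real interval ([coord_surj]). So all points of a block
    but the first one can be moved to each other ([block_move]), and every
    orbit contains one of two points of some block: at most [K] orbits, if [W]
    has at most [K] points and [K] is infinite.

    Conversely, let [W = omega ^ K] and consider the points
    [a xi = omega1 * omega ^ xi] of [L]. Suppose that a homeomorphism of the
    solenoid maps a point over [a zeta] to one over [a xi], where [xi < zeta].
    A short arc that ends at the former point goes into a single thread, since
    it is connected ([thread_local_map]); this gives an injective, hence
    monotone, map from a left neighbourhood of [a zeta] in [L] to a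
    neighbourhood of [a xi]. The ends of the blocks have uncountable
    cofinality from the left, whereas every point but the last one has countable
    cofinality from the right, and inner points of blocks have it from both
    sides ([cofinal_left], [cofinal_right]). So the map is increasing, and maps
    the end of each block to the first point of a block. It thus embeds a final
    segment of [omega ^ zeta], which contains a copy of [omega ^ zeta], into
    [omega ^ xi + 1]: a contradiction ([no_homeomorphism], [power_points]). Hence there are exactly [K] orbits.

    The other two lengths are of this form: [omega1 ^ 2] is
    [omega1 * omega ^ omega1], and a cardinal [K >= omega2] is
    [omega1 * omega ^ K] ([omega1_square_isomorphic], [cardinal_isomorphic]). *)

(** * Injections, and embeddings of ordinals *)

Definition injects (T U : Type) := exists f : T -> U, injective f.

Lemma injects_refl T : injects T T.
Proof. by exists id. Qed.

Lemma injects_trans U T V : injects T U -> injects U V -> injects T V.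
Proof. by move=> [f fi] [g gi]; exists (g \o f); exact: inj_comp. Qed.

Lemma injects_prod T T' U U' :
  injects T T' -> injects U U' -> injects (T * U) (T' * U').
Proof.
move=> [f fi] [g gi]; exists (fun z => (f z.1, g z.2)).
by move=> [x y] [x' y'] [/fi -> /gi ->].
Qed.

Lemma card_leTT_injects T U : [set: T] #<= [set: U] <-> injects T U.
Proof.
split=> [/card_leP[f]|[f]]; last exact: inj_cardT.
exists (fun x => set_val (f (SigSub (mem_set (I : [set: T] x))))) => x y /val_inj.
by move=> /(@inj _ _ _ f _ _ (mem_set I) (mem_set I))[].
Qed.

Lemma injects_infinite T : infinite_set [set: T] <-> injects nat T.
Proof. by rewrite infiniteP card_leTT_injects. Qed.

Definition embeds (A B : ord) := exists f : A -> B, {homo f : x y / x < y}.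

Lemma embeds_refl A : embeds A A.
Proof. by exists id. Qed.

Lemma embeds_trans B A C : embeds A B -> embeds B C -> embeds A C.
Proof. by move=> [f fh] [g gh]; exists (g \o f) => x y /fh/gh. Qed.

Lemma homo_lt_inj d d' (T : orderType d) (U : orderType d') (f : T -> U) :
  {homo f : x y / x < y} -> injective f.
Proof. by move=> /le_mono; exact: inc_inj. Qed.

Lemma embeds_injects (A B : ord) : embeds A B -> injects A B.
Proof. by move=> [f /homo_lt_inj fi]; exists f. Qed.

Lemma ord_least (A : ord) (P : set A) : P !=set0 ->
  exists2 m, P m & forall x, P x -> m <= x.
Proof.
move=> [x Px]; have [|m [[mP mmin] _]] := @ord_wo A [pred x | `[< P x >]].
  by exists x; apply/asboolP.
by exists m; [exact/asboolP|move=> y Py; apply: mmin; apply/asboolP].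
Qed.

(** If [f x < x], then [f (f x) < f x], so that no such [x] is least. *)
Lemma homo_lt_ge (A : ord) (f : A -> A) : {homo f : x y / x < y} ->
  forall x, x <= f x.
Proof.
move=> fh; elim/(well_founded_ind (@ord_wf A)) => x IH; rewrite leNgt.
by apply/negP => fx; have := IH _ fx; rewrite leNgt (fh _ _ fx).
Qed.

Lemma initial_homo_lt (A B : ord) (f : A -> B) :
  initial_embedding f -> {homo f : x y / x < y}.
Proof. by move=> [fm _] x y; rewrite (leW_mono fm). Qed.

Lemma ord_le_embeds A B : ord_le A B -> embeds A B.
Proof. by move=> [f /initial_homo_lt fh]; exists f. Qed.

(** Among strictly increasing maps into [Z], an initial embedding grows
    slowest. *)
Lemma initial_embedding_le (A B Z : ord) (f : A -> Z) (g : B -> Z) (k : A -> B) :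
  initial_embedding f -> {homo g : x y / x < y} -> {homo k : x y / x < y} ->
  forall a, f a <= g (k a).
Proof.
move=> [fm fi] gh kh; elim/(well_founded_ind (@ord_wf A)) => a IH.
rewrite leNgt; apply/negP => lt_gf; have [a' a'E] := fi _ _ (ltW lt_gf).
have a'a : a' < a by rewrite -(leW_mono fm) a'E.
by have := IH _ a'a; rewrite a'E leNgt gh // kh.
Qed.

Lemma common_bound (A B : ord) : exists Z, ord_le A Z /\ ord_le B Z.
Proof.
have [Z [b bij_b]] := wo_type (set (A + B)%type).
have nZ : ~ injects Z (A + B)%type.
  move=> ZAB; apply: (@cantor (A + B)%type); apply/card_leTT_injects.
  by apply: injects_trans ZAB; exists b; exact: bij_inj.
exists Z; split; apply: initial_embedding_exists => /card_leTT_injects ZA; apply: nZ.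
- by apply: injects_trans ZA _; exists inl => x y [].
- by apply: injects_trans ZA _; exists inr => x y [].
Qed.

Lemma embeds_ord_le A B : embeds A B -> ord_le A B.
Proof.
move=> [k kh]; have [Z [[f fI] [g gI]]] := common_bound A B.
have /choice[h hP] : forall a, exists b, g b = f a.
  move=> a; apply: (proj2 gI (k a)).
  exact: initial_embedding_le fI (initial_homo_lt gI) kh a.
have [fm fi] := fI; have [gm gi] := gI.
have hm : {mono h : x y / x <= y} by move=> x y; rewrite -gm !hP fm.
exists h; split=> // a b ba.
have [a' a'E] : exists a', f a' = g b by apply: (fi a); rewrite -hP gm.
by exists a'; apply/eqP; rewrite eq_le -!gm !hP a'E lexx.
Qed.

Lemma sub_ord_ltE (A : ord) (P : {pred A}) (x y : Defs.sub_ord P) :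
  (x < y) = (val x < val y).
Proof. by rewrite !ltNge sub_ord_leE. Qed.

Lemma embeds_segment (A : ord) (a : A) : embeds (segment a) A.
Proof. by exists val => x y; rewrite sub_ord_ltE. Qed.

Lemma embeds_segment_le (A : ord) (a b : A) :
  a <= b -> embeds (segment a) (segment b).
Proof.
move=> ab; exists (fun x : segment a => exist _ (val x) (lt_le_trans (valP x) ab)).
by move=> x y; rewrite !sub_ord_ltE.
Qed.

(** Trichotomy of ordinals. *)
Lemma embeds_or_segment (A B : ord) :
  embeds A B \/ exists a : A, embeds B (segment a).
Proof.
have [Z [[f fI] [g gI]]] := common_bound A B.
have [[a aP]|/forallNP H] := pselect (exists a, forall b, g b < f a).
  right; exists a; have [fm fi] := fI.
  have /choice[h hP] : forall b, exists a', f a' = g b.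
    by move=> b; apply: (fi a); exact: ltW.
  have ha b : h b < a by rewrite -(leW_mono fm) hP aP.
  exists (fun b => exist _ (h b) (ha b) : segment a) => x y xy.
  by rewrite sub_ord_ltE /= -(leW_mono fm) !hP (initial_homo_lt gI).
left; have /choice[h hP] : forall a, exists b, g b = f a.
  move=> a; have /existsNP[b] := H a; move/negP; rewrite -leNgt => ab.
  exact: (proj2 gI b).
exists h => x y xy; rewrite -(leW_mono (proj1 gI)) !hP.
exact: (initial_homo_lt fI).
Qed.

Lemma embeds_small_segments (A B : ord) :
  (forall a : A, ~ injects B (segment a)) -> embeds A B.
Proof.
by move=> nBA; have [//|[a /embeds_injects/nBA]] := embeds_or_segment A B.
Qed.

Lemma embeds_anti (A B : ord) : embeds A B -> embeds B A ->
  exists (f : A -> B) (g : B -> A),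
    [/\ {mono f : x y / x <= y}, cancel f g & cancel g f].
Proof.
move=> /embeds_ord_le[f fI] [g gh]; have [fm fi] := fI.
have /choice[h hP] : forall b, exists a, f a = b.
  move=> b; apply: (fi (g b)); apply: (@homo_lt_ge B (f \o g)) => x y /gh.
  exact: initial_homo_lt.
exists f, h; split=> // a; apply: (homo_lt_inj (initial_homo_lt fI)).
by rewrite hP.
Qed.

Lemma injects_total T U : injects T U \/ injects U T.
Proof.
have [A [f fb]] := wo_type T; have [B [g gb]] := wo_type U.
have fi : injects T A by exists f; exact: bij_inj.
have gi : injects U B by exists g; exact: bij_inj.
have [f' ff' f'f] := fb; have [g' gg' g'g] := gb.
have f'i : injects A T by exists f'; exact: can_inj f'f.
have g'i : injects B U by exists g'; exact: can_inj g'g.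
have [AB|[a Ba]] := embeds_or_segment A B; [left|right].
- exact: injects_trans fi (injects_trans (embeds_injects AB) g'i).
- apply: injects_trans gi (injects_trans _ f'i).
  exact: embeds_injects (embeds_trans Ba (embeds_segment a)).
Qed.

(** * Squares of infinite sets *)

Lemma injects_option T : injects nat T -> injects (option T) T.
Proof.
move=> [f fi].
pose g (z : option T) := if z is Some x then
  (if pselect (exists n, f n = x) is left e then f (sval (cid e)).+1 else x)
  else f 0%N.
exists g; case=> [x|] [y|] //=; do ?[case: pselect => [e|ne]];
  do ?[case: pselect => [e'|ne']].
- by case: (cid e) => n /= <-; case: (cid e') => m /= <- /fi[->].
- by move=> E; case: ne'; rewrite -E; eexists.
- by move=> E; case: ne; rewrite E; eexists.
- by move=> ->.
- by move=> /fi.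
- by move=> E; case: ne; rewrite E; eexists.
- by move=> /fi.
- by move=> E; case: ne; rewrite -E; eexists.
Qed.

Lemma finite_option T : ~ injects nat T -> ~ injects nat (option T).
Proof.
rewrite -!injects_infinite => /contrapT fT; apply.
suff -> : [set: option T] = (some @` [set: T]) `|` [set None].
  by rewrite finite_setU; split; [exact: finite_image|exact: finite_set1].
by apply/seteqP; split => // -[x|] _; [left; exists x|right].
Qed.

Lemma finite_prod T U :
  ~ injects nat T -> ~ injects nat U -> ~ injects nat (T * U).
Proof.
rewrite -!injects_infinite => /contrapT fT /contrapT fU; apply.
by rewrite -setXTT; exact: finite_setX.
Qed.

(** Goedel's ordering of pairs by their maximum: if no proper initial segment
    of [A] is equipotent to [A], then all proper initial segments of [A * A]
    are too small to receive [A]. *)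
Lemma square_step (A : ord) :
  (forall a : A, injects nat (segment a) ->
     injects (segment a * segment a) (segment a)) ->
  injects nat A -> injects (A * A) A.
Proof.
move=> IH infA.
have [[a Aa]|/forallNP nseg] := pselect (exists a : A, injects A (segment a)).
  have aA := embeds_injects (embeds_segment a).
  apply: injects_trans (injects_prod Aa Aa) (injects_trans (IH a _) aA).
  exact: injects_trans infA Aa.
pose T := ord_mul (ord_mul A A) A.
pose P : {pred T} := [pred z | z.1 == Order.max z.2.1 z.2.2].
pose B := Defs.sub_ord P.
have AAB : injects (A * A) B.
  exists (fun u => exist _ (Order.max u.1 u.2, u) (eqxx _) : B).
  by move=> u v [].
apply: injects_trans AAB _; apply: embeds_injects.
apply: embeds_small_segments => b Ab.
pose m := (val b).1; pose S := option (segment m).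
have SA : ~ injects A S.
  move=> AS; apply: (nseg m); apply: (injects_trans AS).
  by apply: injects_option; apply: contrapT => /finite_option; apply;
    exact: injects_trans infA AS.
have bSS : injects (segment b) (S * S).
  have /choice[g gP] : forall x : A, exists s : S,
      x <= m -> oapp val m s = x.
    move=> x; have [xm|mx] := ltP x m; first by exists (Some (exist _ x xm)).
    by exists None => xm /=; apply/eqP; rewrite eq_le xm mx.
  exists (fun c : segment b => (g (val (val c)).2.1, g (val (val c)).2.2)).
  have cE (c : segment b) :
      (val (val c)).1 = Order.max (val (val c)).2.1 (val (val c)).2.2.
    exact/eqP/(valP (val c)).
  have le_m (c : segment b) : ((val (val c)).2.1 <= m) && ((val (val c)).2.2 <= m).
    have := ltW (valP c : val c < b).
    by rewrite sub_ord_leE leEprodlexi cE ge_max => /andP[].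
  move=> c c' [Ex Ey]; apply: val_inj; apply: val_inj.
  have /andP[cx cy] := le_m c; have /andP[c'x c'y] := le_m c'.
  have {}Ex : (val (val c)).2.1 = (val (val c')).2.1 by rewrite -(gP _ cx) Ex gP.
  have {}Ey : (val (val c)).2.2 = (val (val c')).2.2 by rewrite -(gP _ cy) Ey gP.
  have E1 : (val (val c)).1 = (val (val c')).1 by rewrite !cE Ex Ey.
  move: E1 Ex Ey; case: (val (val c)) => [? [? ?]].
  by case: (val (val c')) => [? [? ?]] /= -> -> ->.
have ASS := injects_trans Ab bSS.
have [infm|finm] := pselect (injects nat (segment m)); last first.
  apply: (@finite_prod S S); try exact: finite_option.
  exact: injects_trans infA ASS.
apply: (nseg m); apply: injects_trans ASS (injects_trans _ (IH m infm)).
by apply: injects_prod; exact: injects_option.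
Qed.

Lemma injects_square T : injects nat T -> injects (T * T) T.
Proof.
have [W [f [g fK gK]]] := wo_type T.
have TW : injects T W by exists f; exact: can_inj fK.
have WT : injects W T by exists g; exact: can_inj gK.
move=> infT; apply: injects_trans (injects_prod TW TW) (injects_trans _ WT).
apply: square_step; last exact: injects_trans infT TW.
elim/(well_founded_ind (@ord_wf W)) => w IH; apply: square_step => v.
have vvw : embeds (segment v) (segment (val v)).
  exists (fun x : segment v =>
    exist _ (val (val x)) (eq_ind _ is_true (valP x) _ (sub_ord_ltE _ _))
    : segment (val v)).
  by move=> x y; rewrite !sub_ord_ltE.
have wvv : embeds (segment (val v)) (segment v).
  have lt_w (x : segment (val v)) : val x < w := lt_trans (valP x) (valP v).
  have lt_v (x : segment (val v)) : (exist _ (val x) (lt_w x) : segment w) < v.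
    by rewrite sub_ord_ltE; exact: (valP x).
  exists (fun x => exist _ (exist _ (val x) (lt_w x) : segment w) (lt_v x)).
  by move=> x y; rewrite !sub_ord_ltE.
move=> infv; have {vvw wvv} [vv vv'] := (embeds_injects vvw, embeds_injects wvv).
apply: injects_trans (injects_prod vv vv) (injects_trans _ vv').
by apply: IH (valP v) _; exact: injects_trans infv vv.
Qed.

(** * Suprema of ordinals and powers of [omega] *)

Lemma ord_supP (I : Type) (F : I -> ord) : is_sup F (ord_sup F).
Proof. exact: (svalP (cid (is_sup_exists F))). Qed.

Lemma ord_sup_ge (I : Type) (F : I -> ord) i : ord_le (F i) (ord_sup F).
Proof. exact: (proj1 (ord_supP F)). Qed.

Lemma ord_sup_le (I : Type) (F : I -> ord) W :
  (forall i, embeds (F i) W) -> embeds (ord_sup F) W.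
Proof.
move=> FW; apply: ord_le_embeds; apply: (proj2 (ord_supP F)) => i.
exact: embeds_ord_le.
Qed.

Lemma initial_segment (A B : ord) (f : A -> B) (b : B) :
  initial_embedding f -> (forall a, f a != b) -> forall a, f a < b.
Proof.
move=> [_ fi] nb a; rewrite ltNge; apply/negP => /fi[a' a'b].
by have := nb a'; rewrite a'b eqxx.
Qed.

Lemma ord_sup_embeddings (I : Type) (F : I -> ord) :
  exists f : forall i, F i -> ord_sup F, forall i, initial_embedding (f i).
Proof.
exists (fun i => sval (cid (ord_sup_ge F i))) => i.
exact: (svalP (cid (ord_sup_ge F i))).
Qed.

(** A point that no [F i] reaches would yield a smaller upper bound, namely its
    initial segment. *)
Lemma ord_sup_cover (I : Type) (F : I -> ord) (f : forall i, F i -> ord_sup F) :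
  (forall i, initial_embedding (f i)) -> forall w, exists i x, f i x = w.
Proof.
move=> fI w; apply: contrapT => nw.
have Fw i : embeds (F i) (segment w).
  have fw : forall x, f i x < w.
    by apply: initial_segment => // x; apply/eqP => fx; apply: nw; exists i, x.
  exists (fun x => exist _ (f i x) (fw x)) => x y xy.
  by rewrite sub_ord_ltE; exact: initial_homo_lt xy.
have [g gh] := ord_sup_le Fw.
have vgh : {homo (val \o g) : x y / x < y} by move=> x y /gh; rewrite sub_ord_ltE.
have := homo_lt_ge vgh w; rewrite leNgt => /negP; apply.
exact: (valP (g w)).
Qed.

Lemma injects_ord_sup (I : Type) (F : I -> ord) (M : Type) : injects nat M ->
  injects I M -> (forall i, injects (F i) M) -> injects (ord_sup F) M.
Proof.
move=> infM [m mi] FM; have [f fI] := ord_sup_embeddings F.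
have /choice[s sP] : forall w, exists u : {i & F i}, f (tag u) (tagged u) = w.
  by move=> w; have [i [x <-]] := ord_sup_cover fI w; exists (Tagged F x).
apply: (@injects_trans {i & F i}).
  by exists s => w w' ss; rewrite -(sP w) ss sP.
apply: injects_trans (injects_square infM).
exists (fun u => (m (tag u), sval (cid (FM (tag u))) (tagged u))).
move=> [i x] [j y] /= [/mi ij]; subst j.
by move=> /(svalP (cid (FM i))) ->.
Qed.

Lemma exp_step_cases (g A : ord) (E : A -> ord) :
  [\/ (A -> False) /\ exp_step g E = fin_ord 1,
      exists2 b, (forall a, a <= b) & exp_step g E = ord_mul (E b) g |
      [/\ exists a : A, True, forall b, exists a : A, b < a &
          exp_step g E = ord_sup E]].
Proof.
rewrite /exp_step; case: pselect => [A0|nA0]; first by constructor 1.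
case: pselect => [maxA|nmaxA].
  by constructor 2; case: (cid maxA) => b bmax /=; exists b.
constructor 3; split=> //.
  by apply: contrapT => nA; apply: nA0 => a; apply: nA; exists a.
move=> b; apply: contrapT => nb; apply: nmaxA; exists b => a.
by rewrite leNgt; apply/negP => ba; apply: nb; exists a.
Qed.

Definition unbounded (K : ord) := forall a : K, exists b, a < b.

Section powers_of_omega.
Context (K : ord).
Local Notation E := (@ord_exp_at omega K).

Lemma power_cases (a : K) :
  [\/ (forall b, ~ b < a) /\ E a = fin_ord 1,
      exists b, [/\ b < a, forall c, c < a -> c <= b & E a = ord_mul (E b) omega] |
      [/\ exists b, b < a, forall b, b < a -> exists2 c, b < c & c < a &
          E a = ord_sup (fun b : segment a => E (val b))]].
Proof.
rewrite ord_exp_atE.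
case: (exp_step_cases omega (fun b : segment a => E (val b))).
- by move=> [a0 ->]; constructor 1; split=> // b ba; exact: a0 (exist _ b ba).
- move=> [b bmax ->]; constructor 2; exists (val b); split=> //.
    exact: (valP b).
  by move=> c ca; have := bmax (exist _ c ca); rewrite sub_ord_leE.
- move=> [[b _] nomax ->]; constructor 3; split=> //.
    by exists (val b); exact: (valP b).
  move=> c ca; have [d] := nomax (exist _ c ca); rewrite sub_ord_ltE => cd.
  by exists (val d) => //; exact: (valP d).
Qed.

Lemma mul_ltE (A B : ord) (x y : ord_mul A B) :
  (x < y) = (x.1 < y.1) || ((x.1 == y.1) && (x.2 < y.2)).
Proof.
by rewrite ltEprodlexi; case: (ltgtP x.1 y.1).
Qed.

Lemma embeds_mul (A A' B B' : ord) :
  embeds A A' -> embeds B B' -> embeds (ord_mul A B) (ord_mul A' B').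
Proof.
move=> [f fh] [g gh]; exists (fun z => (g z.1, f z.2)) => z z'.
rewrite !mul_ltE /= => /orP[/gh ->//|/andP[/eqP -> /fh ->]].
by rewrite eqxx orbT.
Qed.

Lemma embeds_mul_omega (A : ord) : embeds A (ord_mul A omega).
Proof.
by exists (pair 0%N) => x y xy; rewrite mul_ltE; apply/orP; right; rewrite eqxx.
Qed.

Lemma power_mul_embeds (b a : K) : b < a -> embeds (ord_mul (E b) omega) (E a).
Proof.
elim/(well_founded_ind (@ord_wf K)): a => a IH ba; case: (power_cases a).
- by move=> [/(_ b)].
- move=> [c [ca cmax ->]]; apply: embeds_mul; last exact: embeds_refl.
  have [->|bc] := eqVneq b c; first exact: embeds_refl.
  have /(IH _ ca) : b < c by rewrite lt_neqAle bc cmax.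
  apply: embeds_trans; exact: embeds_mul_omega.
- move=> [_ nomax ->]; have [c bc ca] := nomax _ ba.
  apply: embeds_trans (IH _ ca bc) (ord_le_embeds _).
  exact: (ord_sup_ge (fun b : segment a => E (val b)) (exist _ c ca)).
Qed.

(** Powers of [omega] are additively indecomposable: a final segment contains a
    copy of the whole. *)
Lemma power_tail (a : K) (t : E a) :
  exists2 f : E a -> E a, {homo f : x y / x < y} & forall x, t <= f x.
Proof.
elim/(well_founded_ind (@ord_wf K)): a t => a IH; case: (power_cases a).
- move=> [_ ->] t; exists id => // x; suff -> : t = x by [].
  by apply: ord_inj; case: t x => [[|?] ?] [[|?] ?].
- move=> [c [ca cmax ->]] t; exists (fun x => ((t.1 + x.1).+1, x.2)).
    move=> x y; rewrite !mul_ltE /= => /orP[xy|/andP[/eqP -> ->]].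
      apply/orP; left; suff : ((t.1 + x.1).+1 < (t.1 + y.1).+1)%N by [].
      by rewrite ltnS ltn_add2l; exact: xy.
    by rewrite eqxx orbT.
  move=> x; apply: ltW; rewrite mul_ltE /=; apply/orP; left.
  suff : (t.1 < (t.1 + x.1).+1)%N by [].
  by rewrite ltnS leq_addr.
move=> [_ nomax Ea]; move: (E a) Ea => _ -> t.
have [f0 f0I] := ord_sup_embeddings (fun b : segment a => E (val b)).
have [[b ba] [t' fE]] := ord_sup_cover f0I t.
have [f [fI {}fE]] : exists f : E b -> _, initial_embedding f /\ f t' = t.
  by exists (f0 (exist _ b ba)); split; [exact: f0I (exist _ b ba)|].
pose T := Defs.sub_ord [pred x | t <= x].
suff /ord_le_embeds[h hh] : ord_le (ord_sup (fun b : segment a => E (val b))) T.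
  by exists (fun x => val (h x)) => [x y /hh|x]; [rewrite sub_ord_ltE|exact: (valP (h x))].
apply: embeds_ord_le; apply: ord_sup_le => -[b' b'a] /=.
pose m := Order.max b b'; have ma : m < a by rewrite gt_max (ba : b < a) (b'a : b' < a).
have Ebm c : c <= m -> embeds (E c) (E m).
  rewrite le_eqVlt => /predU1P[->|cm]; first exact: embeds_refl.
  apply: embeds_trans (power_mul_embeds cm).
  exact: embeds_mul_omega.
have [k kh] : embeds (E b) (E m) by apply: Ebm; rewrite le_max lexx.
have [k' k'h] : embeds (E b') (E m) by apply: Ebm; rewrite le_max lexx orbT.
have [g gI] := ord_sup_ge (fun b : segment a => E (val b)) (exist _ m ma).
have gh := initial_homo_lt gI.
have [h hh th] := IH _ ma (k t').
have hT (x : E b') : t <= g (h (k' x)).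
  rewrite -fE; apply: (le_trans (initial_embedding_le fI gh kh t')).
  by rewrite (proj1 gI).
exists (fun x => exist _ (g (h (k' x))) (hT x) : T) => x y xy.
by rewrite sub_ord_ltE /=; apply/gh/hh/k'h.
Qed.

Lemma power_inhabited (a : K) : exists t : E a, True.
Proof.
elim/(well_founded_ind (@ord_wf K)): a => a IH; case: (power_cases a).
- by move=> [_ ->]; exists ord0.
- by move=> [b [ba _ ->]]; have [t _] := IH _ ba; exists (0%N, t).
- move=> [[b ba] _ ->]; have [t _] := IH _ ba.
  have [f _] := ord_sup_ge (fun b : segment a => E (val b)) (exist _ b ba).
  by exists (f t).
Qed.

Lemma power_card (M : Type) (a : K) :
  injects nat M -> injects (segment a) M -> injects (E a) M.
Proof.
move=> infM; elim/(well_founded_ind (@ord_wf K)): a => a IH aM.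
have ltM b : b < a -> injects (segment b) M.
  move=> ba; apply: injects_trans aM.
  exact: embeds_injects (embeds_segment_le (ltW ba)).
case: (power_cases a).
- move=> [_ ->]; have [f fi] := infM; exists (fun=> f 0%N) => x y _.
  by apply: ord_inj; case: x y => [[|?] ?] [[|?] ?].
- move=> [b [ba _ ->]]; have bM := IH b ba (ltM b ba).
  exact: injects_trans (injects_prod infM bM) (injects_square infM).
- move=> [_ _ ->]; apply: injects_ord_sup => // -[b ba] /=.
  exact: IH (ltM b ba).
Qed.

Lemma ord_exp_sup : unbounded K -> (exists a : K, True) -> ord_exp omega K = ord_sup E.
Proof.
move=> nomax [a _]; case: (exp_step_cases omega E) => [[/(_ a)]|[b bmax]|[]] //.
by have [c] := nomax b; rewrite ltNge bmax.
Qed.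

End powers_of_omega.

(** A copy of [A] in [A] that leaves a point above it is impossible. *)
Lemma not_embeds_mul_omega (A : ord) (a : A) : ~ embeds (ord_mul A omega) A.
Proof.
move=> [f fh]; have gh : {homo (fun x => f (0%N, x)) : x y / x < y}.
  by move=> x y xy; apply: fh; rewrite mul_ltE eqxx xy orbT.
have := homo_lt_ge gh (f (1%N, a)); rewrite leNgt fh //.
Qed.

(** The points [omega ^ xi] of [omega ^ K]: their final segments are pairwise
    different in length, since each contains a copy of the whole. *)
Lemma power_points (K : ord) : unbounded K -> exists w : K -> ord_exp omega K,
  [/\ {homo w : x y / x < y}, forall xi, exists b, b < w xi &
    forall xi zeta, xi < zeta -> forall b, b < w zeta -> forall f,
    (forall s, b < s < w zeta -> f s <= w xi) ->
    ~ (forall s t, b < s -> s < t -> t < w zeta -> f s < f t)].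
Proof.
move=> nomax; have [[x0 _]|nK] := pselect (exists a : K, True); last first.
  by exists (fun x => False_rect _ (nK (ex_intro _ x I))); split=> x *; case: nK; exists x.
rewrite (ord_exp_sup nomax (ex_intro _ x0 I)).
set E := ord_exp_at omega (A := K); set W := ord_sup E.
have EW a : embeds (E a) W by exact: ord_le_embeds (ord_sup_ge E a).
have [k kI] := ord_sup_embeddings E.
have /choice[w wP] : forall a, exists w, (forall x, k a x < w) /\
    forall s, s < w -> exists x, k a x = s.
  move=> a; have [e _] := power_inhabited a; have [b ab] := nomax a.
  have [|w /= nw wmin] := @ord_least W [set w | forall x, k a x != w].
    apply: contrapT => nex; apply: (not_embeds_mul_omega e).
    apply: embeds_trans (embeds_trans (power_mul_embeds ab) (EW b)) _.
    have /choice[h hP] : forall w, exists x, k a x = w.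
      move=> w; apply: contrapT => nx; apply: nex; exists w => x /=.
      by apply/eqP => kx; apply: nx; exists x.
    by exists h => x y xy; rewrite -(leW_mono (proj1 (kI a))) !hP.
  exists w; split; first exact: initial_segment.
  move=> s sw; apply: contrapT => nx.
  have /wmin : forall x, k a x != s.
    by move=> x; apply/eqP => kx; apply: nx; exists x.
  by rewrite leNgt sw.
have kh a := initial_homo_lt (kI a).
exists w; split=> [xi zeta xz|xi|xi zeta xz b bw f fle fh].
  rewrite ltNge; apply/negP => zx; have [e _] := power_inhabited xi.
  apply: (not_embeds_mul_omega e); apply: embeds_trans (power_mul_embeds xz) _.
  have /choice[h hP] : forall x, exists y, k xi y = k zeta x.
    by move=> x; apply: (proj2 (wP xi)); exact: lt_le_trans (proj1 (wP zeta) x) zx.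
  by exists h => x y xy; rewrite -(leW_mono (proj1 (kI xi))) !hP kh.
  by have [e _] := power_inhabited xi; exists (k xi e); exact: (proj1 (wP xi)).
have [kw kws] := wP zeta; have [kxw kxws] := wP xi.
have [t kt] := kws _ bw; have [T Th Tt] := power_tail t.
have [g gh] := power_mul_embeds xz; have [e _] := power_inhabited xi.
(* [u] embeds [omega ^ xi * omega] above [b]; the first copy is shifted by one,
   so as to stay strictly above [b]. *)
pose u (n : nat) x := k zeta (T (g (n.+1, x))).
have uh n m x y : (n < m)%N || ((n == m) && (x < y)) -> u n x < u m y.
  move=> nm; apply/kh/Th/gh; rewrite mul_ltE /=.
  suff -> : (n.+1 < m.+1) = (n < m)%N by rewrite eqSS.
  exact: ltnS.
have ub n x : b < u n x.
  rewrite -kt; apply: (@le_lt_trans _ _ (k zeta (T (g (0%N, e))))).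
    by rewrite (proj1 (kI zeta)).
  by apply/kh/Th/gh; rewrite mul_ltE.
have uw n x : u n x < w zeta by exact: kw.
have fuh n m x y : (n < m)%N || ((n == m) && (x < y)) -> f (u n x) < f (u m y).
  by move=> nm; apply: fh => //; exact: uh.
have fuw n x : (n < 2)%N -> f (u n x) < w xi.
  move=> n2; apply: (@lt_le_trans _ _ (f (u 2%N e))); first by rewrite fuh ?n2.
  by apply: fle; rewrite ub uw.
(* The images of the copies [0] and [1] lie below [w xi] because that of the
   copy [2] is bounded by it. *)
have [v vP] := kxws _ (fuw 1%N e isT).
have /choice[h hP] : forall x, exists y, k xi y = f (u 0%N x).
  by move=> x; apply: kxws; exact: fuw.
have hh : {homo h : x y / x < y}.
  move=> x y xy; rewrite -(leW_mono (proj1 (kI xi))) !hP; apply: fuh.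
  by rewrite xy orbT.
have := homo_lt_ge hh v; rewrite leNgt -(leW_mono (proj1 (kI xi))) hP vP.
by rewrite fuh.
Qed.

(** * Cardinals, and the lengths [omega1 * omega ^ K] *)

Lemma segment_card_eq (A : ord) (a : A) : [set x | x < a] #= [set: segment a].
Proof.
rewrite (_ : [set x | _] = val @` [set: segment a]).
  by apply: inj_card_eq => x y _ _; exact: val_inj.
apply/seteqP; split=> [x xa|_ [x _ <-]]; last exact: (valP x).
by exists (exist _ x xa : segment a).
Qed.

Lemma cardinal_segment (K : ord) (a : K) : is_cardinal K -> ~ injects K (segment a).
Proof.
move=> cK Ka; apply: (cK a); rewrite card_eq_sym.
apply/card_eqPle; split; last exact: card_leT.
rewrite (card_le_eqr (segment_card_eq a)); exact/card_leTT_injects.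
Qed.

Lemma infinite_cardinal_unbounded (K : ord) :
  is_infinite_cardinal K -> unbounded K.
Proof.
move=> [cK /injects_infinite infK] a; apply: contrapT => amax.
have Ka : injects K (option (segment a)).
  have le_a x : x <= a by rewrite leNgt; apply/negP => ax; apply: amax; exists x.
  have /choice[g gP] : forall x : K, exists s : option (segment a), oapp val a s = x.
    move=> x; have [xa|] := ltP x a; first by exists (Some (exist _ x xa)).
    by move=> ax; exists None; apply/eqP; rewrite eq_le ax le_a.
  by exists g => x y gxy; rewrite -(gP x) gxy gP.
apply: (@cardinal_segment K a cK); apply: (injects_trans Ka); apply: injects_option.
by apply: contrapT => /finite_option; apply; exact: injects_trans infK Ka.
Qed.

Lemma inhabited_infinite (K : ord) : infinite_set [set: K] -> exists a : K, True.
Proof. by move=> /infinite_setN0[a]; exists a. Qed.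

(** [omega ^ K] is the union of [K] sets of cardinality at most [K]. *)
Lemma injects_ord_exp_omega (K : ord) :
  is_infinite_cardinal K -> injects (ord_exp omega K) K.
Proof.
move=> infK; have nomax := infinite_cardinal_unbounded infK.
have [_ /[dup] /inhabited_infinite Kx /injects_infinite infT] := infK.
rewrite ord_exp_sup //; apply: injects_ord_sup => // [|a]; first exact: injects_refl.
apply: power_card => //; exact: embeds_injects (embeds_segment a).
Qed.

Lemma ord_exp_omega_segment (K : ord) (w : ord_exp omega K) :
  unbounded K -> (exists a : K, True) ->
  exists b : K, injects (segment w) (@ord_exp_at omega K b).
Proof.
move=> nomax Kx; move: w; rewrite ord_exp_sup // => w.
have [f fI] := ord_sup_embeddings (@ord_exp_at omega K).
have [b [x fx]] := ord_sup_cover fI w; exists b.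
have /choice[g gP] : forall s : segment w, exists y, f b y = val s.
  by move=> s; apply: (proj2 (fI b) x); rewrite fx; exact/ltW/(valP s).
by exists g => s t gst; apply: val_inj; rewrite -!gP gst.
Qed.

Lemma next_cardinalP (A : ord) : is_next_cardinal A (next_cardinal A).
Proof. exact: (svalP (cid (is_next_cardinal_exists A))). Qed.

Lemma next_cardinal_not_injects (A : ord) : ~ injects (next_cardinal A) A.
Proof.
by move=> /card_leTT_injects; exact: (proj1 (next_cardinalP A)).
Qed.

Lemma next_cardinal_segment (A : ord) (a : next_cardinal A) : injects (segment a) A.
Proof.
apply/card_leTT_injects; rewrite -(card_le_eql (segment_card_eq a)).
exact: (proj2 (next_cardinalP A)).
Qed.

Lemma injects_next_cardinal (A : ord) : injects A (next_cardinal A).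
Proof.
by have [//|/next_cardinal_not_injects] := injects_total A (next_cardinal A).
Qed.

Lemma omega1_infinite_cardinal : is_infinite_cardinal omega1.
Proof.
split; last by apply/injects_infinite; exact: (injects_next_cardinal omega).
move=> a /card_esym/card_eqPle[+ _]; rewrite (card_le_eqr (segment_card_eq a)).
move=> /card_leTT_injects H; apply: (@next_cardinal_not_injects omega).
exact: injects_trans H (next_cardinal_segment a).
Qed.

Lemma omega_infinite_cardinal : is_infinite_cardinal omega.
Proof.
split=> [n|]; last exact: infinite_nat.
move=> /card_esym E; apply: infinite_nat; exists n; apply: card_eq_trans E _.
by rewrite (_ : [set x | x < n] = `I_n).
Qed.

(** By [embeds_anti], mutual embeddings yield an isomorphism. *)
Definition isomorphic (A B : ord) := embeds A B /\ embeds B A.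

Lemma ord_exp_2 (g : ord) :
  ord_exp g (fin_ord 2) = ord_mul (ord_mul (fin_ord 1) g) g.
Proof.
pose i0 : fin_ord 2 := ord0; pose i1 : fin_ord 2 := ord_max.
have le_i1 (i : fin_ord 2) : i <= i1 by exact: leq_ord.
have lt01 : i0 < i1 by [].
have eq_i0 (i : fin_ord 2) : i < i1 -> i = i0.
  by case: i => [[|[|//]] ?] // _; exact: ord_inj.
have E0 : ord_exp_at g i0 = fin_ord 1.
  rewrite ord_exp_atE; case: (exp_step_cases g (fun b : segment i0 => ord_exp_at g (val b))) =>
    [[_ ->]//|[c _ _]|[[c _] _ _]];
    by have := valP c.
have E1 : ord_exp_at g i1 = ord_mul (fin_ord 1) g.
  rewrite ord_exp_atE; case: (exp_step_cases g (fun b : segment i1 => ord_exp_at g (val b))) =>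
    [[no _]|[c _ ->]|[[c _] nomax _]].
  - by case: (no (exist _ i0 lt01)).
  - by rewrite (eq_i0 _ (valP c)) E0.
  - have [d] := nomax c; rewrite sub_ord_ltE (eq_i0 _ (valP c)).
    by rewrite (eq_i0 _ (valP d)) ltxx.
rewrite /ord_exp; case: (exp_step_cases g (@ord_exp_at g (fin_ord 2))) =>
  [[/(_ i0)]//|[b bmax ->]|[_ nomax _]].
  have -> : b = i1 by apply/eqP; rewrite eq_le le_i1 bmax.
  by rewrite E1.
by have [i] := nomax i1; rewrite ltNge le_i1.
Qed.

(** Initial segments of [omega ^ omega1] are countable. *)
Lemma omega1_power_embeds_omega1 : embeds (ord_exp omega omega1) omega1.
Proof.
have nomax := infinite_cardinal_unbounded omega1_infinite_cardinal.
have [_ /inhabited_infinite x1] := omega1_infinite_cardinal.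
apply: embeds_small_segments => w Ww; apply: (@next_cardinal_not_injects omega).
apply: injects_trans Ww _; have [b wb] := ord_exp_omega_segment w nomax x1.
apply: injects_trans wb _; apply: power_card; first exact: injects_refl.
exact: next_cardinal_segment.
Qed.

Lemma embeds_power (K : ord) : unbounded K -> embeds K (ord_exp omega K).
Proof. by move=> /power_points[w [wh _ _]]; exists w. Qed.

Lemma omega1_square_isomorphic :
  isomorphic (ord_exp omega1 (fin_ord 2)) (ord_mul omega1 (ord_exp omega omega1)).
Proof.
rewrite ord_exp_2; split; apply: embeds_mul.
- exists fst => x y; rewrite mul_ltE /= => /orP[//|/andP[_]].
  by case: x.2 y.2 => [[|?] ?] [[|?] ?].
- exact/embeds_power/infinite_cardinal_unbounded/omega1_infinite_cardinal.
- by exists (fun x => (x, ord0)) => x y xy; rewrite mul_ltE /= xy.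
- exact: omega1_power_embeds_omega1.
Qed.

Lemma infinite_ge_omega2 (K : ord) : ord_le omega2 K -> infinite_set [set: K].
Proof.
move=> /ord_le_embeds/embeds_injects o2K; apply/injects_infinite.
apply: injects_trans (injects_next_cardinal omega) _.
exact: injects_trans (injects_next_cardinal omega1) o2K.
Qed.

(** Initial segments of [omega1 * omega ^ K] have cardinality less than that of
    [K], as each lies in [omega1 * omega ^ b * 2] for some [b < K]. *)
Lemma cardinal_isomorphic (K : ord) : is_cardinal K -> ord_le omega2 K ->
  isomorphic K (ord_mul omega1 (ord_exp omega K)).
Proof.
move=> cK o2K'; have infK : is_infinite_cardinal K.
  by split=> //; exact: infinite_ge_omega2.
have o2K := embeds_injects (ord_le_embeds o2K').
have nK1 : ~ injects K omega1.
  by move=> K1; apply: (@next_cardinal_not_injects omega1); exact: injects_trans o2K K1.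
have o1K : injects omega1 K.
  exact: injects_trans (injects_next_cardinal omega1) o2K.
have inf1 : injects nat omega1 := injects_next_cardinal omega.
have nomax := infinite_cardinal_unbounded infK.
have Kx := inhabited_infinite (proj2 infK).
have [f0 _] := inf1; split.
  apply: embeds_trans (embeds_power nomax) _.
  exists (fun x => (x, f0 0%N)) => x y xy.
  by rewrite mul_ltE xy.
apply: embeds_small_segments => -[w c] Ka.
have [b wb] := ord_exp_omega_segment w nomax Kx.
have [M [infM o1M bM nKM]] : exists M, [/\ injects nat M, injects omega1 M,
    injects (segment b) M & ~ injects K M].
  have [bo1|o1b] := injects_total (segment b) omega1.
    by exists omega1; split=> //; exact: injects_refl.
  exists (segment b); split=> //; [|exact: injects_refl|].
    exact: injects_trans inf1 o1b.
  by move/cardinal_segment; apply.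
apply: nKM; apply: (injects_trans Ka).
have wM : injects (option (segment w)) M.
  apply: injects_trans (injects_option infM).
  have [g gi] := injects_trans wb (power_card infM bM).
  by exists (omap g) => -[x|] [y|] // [/gi->].
apply: injects_trans (injects_square infM).
apply: injects_trans (injects_prod wM o1M).
have le_w (z : segment ((w, c) : ord_mul omega1 (ord_exp omega K))) : (val z).1 <= w.
  by have := ltW (valP z : val z < _); rewrite leEprodlexi => /andP[].
have /choice[g gP] : forall x, exists s : option (segment w),
    x <= w -> oapp val w s = x.
  move=> x; have [xw|wx] := ltP x w; first by exists (Some (exist _ x xw)).
  by exists None => xw; apply/eqP; rewrite eq_le xw wx.
exists (fun z => (g (val z).1, (val z).2)) => z z' [gz z2]; apply: val_inj.
rewrite [val z]surjective_pairing [val z']surjective_pairing z2.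
by rewrite -(gP _ (le_w z)) gz (gP _ (le_w z')).
Qed.

(** * Circles *)

Section open_sets.
Local Open Scope quotient_scope.

Lemma identification_openE (X : topologicalType) (r : X -> X -> Prop)
    (A : set (identification r)) :
  open A = open (\pi_(identification r) @^-1` A : set X).
Proof. exact: erefl. Qed.

Lemma circle_openP d (L : orderTopologicalType d) n (A : set (circle L n)) :
  open A <-> forall i : 'I_n, open [set x | A (circle_pt i x)].
Proof. by rewrite !identification_openE sigT_openP. Qed.
End open_sets.

Section circles.
Context d (L : orderTopologicalType d) (bot top : L).
Hypothesis bot_min : forall x, bot <= x.
Hypothesis top_max : forall x, x <= top.
Hypothesis bot_top : bot != top.

Local Open Scope quotient_scope.
Local Notation copies n := {i : 'I_n & L}.

Lemma is_firstE (x : L) : is_first x -> x = bot.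
Proof. by move=> xf; apply/eqP; rewrite eq_le xf bot_min. Qed.

Lemma is_lastE (x : L) : is_last x -> x = top.
Proof. by move=> xl; apply/eqP; rewrite eq_le xl top_max. Qed.

Lemma rot_ord n (i : 'I_n) k : ((i + k) %% n < n)%N.
Proof. by rewrite ltn_mod; case: n i => [[]|]. Qed.

Definition rot n k (i : 'I_n) : 'I_n := Ordinal (rot_ord i k).

Lemma rotD n k l (i : 'I_n) : rot k (rot l i) = rot (l + k) i.
Proof. by apply: ord_inj; rewrite /= modnDml addnA. Qed.

(** Each point of a circle has exactly one representative that is not the last
    point of its copy. *)
Definition normal_rep n (i : 'I_n) (x : L) : 'I_n * L :=
  if x == top then (rot 1 i, bot) else (i, x).

Lemma circle_pt_top n (i : 'I_n) :
  circle_pt i top = circle_pt (rot 1 i) bot :> circle L n.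
Proof.
have [iN|iN] := ltnP i.+1 n.
  congr (\pi_(circle L n) _); apply/identificationP/glued_step; split => //=.
  by rewrite addn1 modn_small.
have {iN}iN : i.+1 = n by apply/eqP; rewrite eqn_leq iN ltn_ord.
apply/esym/identificationP/glued_step.
exists (existT _ (rot 1 i) bot), (existT _ i top); split; split => //=.
by rewrite addn1 iN modnn.
Qed.

Lemma circle_pt_normal n (i : 'I_n) x :
  circle_pt i x = circle_pt (normal_rep i x).1 (normal_rep i x).2 :> circle L n.
Proof.
by rewrite /normal_rep; case: eqP => [->|//]; exact: circle_pt_top.
Qed.

(** [normal_rep] respects the two gluing relations, hence separates the points of
    the circle. *)
Lemma circle_pt_eq n (i j : 'I_n) x y :
  circle_pt i x = circle_pt j y :> circle L n <-> normal_rep i x = normal_rep j y.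
Proof.
split=> [xy|E]; last by rewrite circle_pt_normal E -circle_pt_normal.
pose c (u : copies n) := normal_rep (tag u) (tagged u).
have chainP (u v : copies n) : glued (@chain_rel _ L n) u v -> c u = c v.
  elim=> {u v} [[u x'] [v y'] /= [/= uv /is_lastE -> /is_firstE ->]|//|//|u v w _ -> _ ->//].
  rewrite /c /normal_rep /= eqxx (negbTE bot_top); congr pair.
  by apply: ord_inj; rewrite /= addn1 -uv modn_small.
have reprP (z : chain L n) u : z = \pi u -> c (repr z) = c u.
  by move=> zu; apply/chainP/identificationP; rewrite reprK.
have circleP (z t : chain L n) :
    glued (@circle_rel _ L n) z t -> c (repr z) = c (repr t).
  elim=> {z t} [z t [[u x'] [[v y'] []]]|//|//|u v w _ -> _ ->//].
  move=> [zu /= u0 /is_firstE x'E] [tv /= vn /is_lastE y'E].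
  rewrite (reprP _ _ zu) (reprP _ _ tv) {zu tv} x'E y'E /c /normal_rep /=.
  rewrite eqxx (negbTE bot_top); congr pair.
  by apply: ord_inj; rewrite /= addn1 vn u0 modnn.
move/identificationP: xy => /circleP.
by rewrite (reprP _ (existT _ i x) erefl) (reprP _ (existT _ j y) erefl).
Qed.

Lemma circle_pt_inj n (i j : 'I_n) x y : x != top -> y != top ->
  circle_pt i x = circle_pt j y :> circle L n -> i = j /\ x = y.
Proof.
by move=> /negbTE xt /negbTE yt /circle_pt_eq; rewrite /normal_rep xt yt => -[].
Qed.

Lemma circle_pt_repr n (z : circle L n) :
  circle_pt (tag (repr (repr z : chain L n))) (tagged (repr (repr z : chain L n)))
    = z.
Proof.
rewrite /circle_pt; set u := repr _.
rewrite (_ : existT _ (tag u) (tagged u) = u); last by case: (u).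
by rewrite !reprK.
Qed.

Lemma circle_ptP n (z : circle L n) :
  exists (i : 'I_n) x, x != top /\ z = circle_pt i x.
Proof.
pose u := repr (repr z : chain L n).
exists (normal_rep (tag u) (tagged u)).1, (normal_rep (tag u) (tagged u)).2.
split; last by rewrite -circle_pt_normal circle_pt_repr.
by rewrite /normal_rep; case: (eqVneq (tagged u) top).
Qed.

Lemma circle_pt_continuous n (i : 'I_n) : continuous (@circle_pt _ L n i).
Proof.
apply/continuousP => A Ao.
by move/circle_openP: Ao => /(_ i).
Qed.

Lemma circle_continuous n (Z : topologicalType) (f : circle L n -> Z) :
  (forall i : 'I_n, continuous (fun x => f (circle_pt i x))) -> continuous f.
Proof.
move=> fc; apply/continuousP => A Ao.
by apply/circle_openP => i; have /continuousP/(_ A Ao) := fc i.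
Qed.

Lemma circle_pt_image n (i j : 'I_n) (U : set L) x : ~ U bot -> ~ U top ->
  (circle_pt i @` U : set (circle L n)) (circle_pt j x) <-> j = i /\ U x.
Proof.
move=> Ubot Utop; split=> [[y Uy /circle_pt_eq]|[-> Ux]]; last by exists x.
rewrite /normal_rep.
have -> : (y == top) = false by apply/eqP => yt; apply: Utop; rewrite -yt.
case: eqP => [_ [_ yb]|_ [-> <-]]; last by split.
by case: Ubot; rewrite -yb.
Qed.

(** [circle_pt i] is open away from the endpoints. *)
Lemma circle_pt_preimage_open (X : topologicalType) n (h : X -> circle L n)
    (i : 'I_n) (U : set L) :
  continuous h -> open U -> ~ U bot -> ~ U top ->
  open (h @^-1` (circle_pt i @` U)).
Proof.
move=> hc Uo Ubot Utop; move/continuousP: hc; apply; apply/circle_openP => j.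
have E x := circle_pt_image i j x Ubot Utop.
have [ji|ji] := eqVneq j i.
  suff -> : [set x | (circle_pt i @` U : set (circle L n)) (circle_pt j x)] = U.
    exact: Uo.
  by apply/seteqP; split=> [x /E[]//|x Ux]; apply/E.
suff -> : [set x | (circle_pt i @` U : set (circle L n)) (circle_pt j x)] = set0.
  exact: open0.
by apply/seteqP; split=> [x /E[/eqP]|//]; rewrite (negbTE ji).
Qed.
End circles.

(** * Solenoids and their threads *)

Section solenoids.
Context d (L : orderTopologicalType d) (bot top : L).
Hypothesis bot_min : forall x, bot <= x.
Hypothesis top_max : forall x, x <= top.
Hypothesis bot_top : bot != top.
Context (p : nat -> nat).
Hypothesis p_gt0 : forall n, (0 < p n)%N.

Local Open Scope quotient_scope.
Local Notation k := (degree p).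
Local Notation S := (solenoid L p).
Local Notation proj s n := (set_val (s : S) n : circle L (k n)).
Implicit Types i g : forall n, 'I_(k n).

Lemma degree_gt0 n : (0 < k n)%N.
Proof. by elim: n => //= n kn; rewrite muln_gt0 p_gt0. Qed.

(** Compatible families are the points of the inverse limit of the cyclic groups
    of order [k n], which parametrizes the fibres of the solenoid. *)
Definition compatible i := forall n, (i n.+1 %% k n)%N = i n.

Lemma thread_cover i x : compatible i -> forall n,
  circle_cover (circle_pt (i n.+1) x : circle L (k n.+1)) = circle_pt (i n) x.
Proof.
move=> ci n; rewrite (@circle_coverE _ L (p n) (k n) (i n.+1) x).
by congr circle_pt; apply: ord_inj; exact: ci.
Qed.

(** The points over [x] and the copies [i n]; for fixed [i] they form a path
    along one leaf of the solenoid. *)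
Definition thread i (ci : compatible i) x : S :=
  SigSub (mem_set (thread_cover x ci) : (fun n => circle_pt (i n) x) \in _).

Lemma thread_proj i (ci : compatible i) x n : proj (thread ci x) n = circle_pt (i n) x.
Proof. by rewrite /thread set_valE. Qed.

Lemma solenoid_eq (s t : S) : (forall n, proj s n = proj t n) -> s = t.
Proof.
by move=> st; apply: val_inj; apply: functional_extensionality_dep.
Qed.

Lemma solenoid_cover (s : S) n : circle_cover (proj s n.+1) = proj s n.
Proof. exact: (set_valP s). Qed.

(** Represent the coordinates of [s] by points other than the last one: as such
    representatives are unique, they are compatible. *)
Lemma threadP (s : S) :
  exists i (ci : compatible i) x, x != top /\ s = thread ci x.
Proof.
have rP n : exists r : 'I_(k n) * L, r.2 != top /\ proj s n = circle_pt r.1 r.2.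
  by have [i [x xi]] := circle_ptP bot_min top_max bot_top (proj s n); exists (i, x).
pose i n := (sval (cid (rP n))).1; pose x n := (sval (cid (rP n))).2.
have ixP n : x n != top /\ proj s n = circle_pt (i n) (x n).
  exact: (svalP (cid (rP n))).
have ixS n : i n = Ordinal (modn_ord (i n.+1)) /\ x n = x n.+1.
  have [xt sn] := ixP n; have [xtS snS] := ixP n.+1.
  have := solenoid_cover s n; rewrite sn snS.
  rewrite (@circle_coverE _ L (p n) (k n) (i n.+1)).
  by move/(circle_pt_inj bot_min top_max bot_top xtS xt) => [-> ->].
have ci : compatible i by move=> n; have [-> _] := ixS n.
have xE n : x n = x 0%N by elim: n => // n <-; have [_ ->] := ixS n.
exists i, ci, (x 0%N); split; first exact: (proj1 (ixP 0%N)).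
by apply: solenoid_eq => n; rewrite thread_proj -(xE n); exact: (proj2 (ixP n)).
Qed.

Lemma proj_solenoid_continuous n : continuous (fun s : S => proj s n).
Proof.
move=> s; apply: (@continuous_comp S (prod_topology (fun n => circle L (k n))) _
  set_val (fun f => f n)).
  exact: initial_continuous.
exact: (@proj_continuous nat (fun n => circle L (k n)) n).
Qed.

Lemma solenoid_continuous (X : topologicalType) (f : X -> S) :
  (forall n, continuous (fun x => proj (f x) n)) -> continuous f.
Proof.
move=> fc; apply: continuous_comp_initial => x.
apply/cvg_sup => n; move: x.
apply/(@continuousP _ (initial_topology (fun g : prod_topology _ => g n))) => A [B Bo <-].
by have /continuousP/(_ B Bo) := fc n.
Qed.

Lemma thread_continuous i (ci : compatible i) : continuous (thread ci).
Proof.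
apply: solenoid_continuous => n.
rewrite (_ : (fun x => _) = circle_pt (i n)); last first.
  by apply/funext => x; exact: thread_proj.
exact: circle_pt_continuous.
Qed.

(** The map that sends the copy [i] to the copy [i + a] by [f]. *)
Definition circle_shift n (a : nat) (f : L -> L) (z : circle L n) : circle L n :=
  let u := repr (repr z : chain L n) in circle_pt (rot a (tag u)) (f (tagged u)).

Lemma circle_shiftE n a f (i : 'I_n) x : f top = top -> f bot = bot ->
  circle_shift a f (circle_pt i x) = circle_pt (rot a i) (f x).
Proof.
move=> ft fb; pose r (j : 'I_n) y : circle L n := circle_pt (rot a j) (f y).
have rN j y : r j y = r (normal_rep bot top j y).1 (normal_rep bot top j y).2.
  rewrite /normal_rep; case: eqP => [->|//]; rewrite /r ft fb.
  by rewrite (circle_pt_top bot_min top_max) !rotD addnC.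
rewrite /circle_shift -/(r _ _) -[RHS]/(r i x) rN [RHS]rN.
suff -> : normal_rep bot top (tag (repr (repr (circle_pt i x) : chain L n)))
  (tagged (repr (repr (circle_pt i x) : chain L n))) = normal_rep bot top i x by [].
by apply/(circle_pt_eq bot_min top_max bot_top); exact: circle_pt_repr.
Qed.

Lemma circle_shift_continuous n a f : f top = top -> f bot = bot ->
  continuous f -> continuous (@circle_shift n a f).
Proof.
move=> ft fb fc; apply: circle_continuous => i.
rewrite (_ : (fun x => _) = circle_pt (rot a i) \o f); last first.
  by apply/funext => x /=; exact: circle_shiftE.
move=> x; apply: continuous_comp; first exact: fc.
exact: circle_pt_continuous.
Qed.

Lemma compatible_dvd n : (k n %| k n.+1)%N.
Proof. exact: dvdn_mull. Qed.

Lemma circle_shift_cover g f (s : S) : compatible g -> f top = top -> f bot = bot ->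
  forall n, circle_cover (circle_shift (g n.+1) f (proj s n.+1) : circle L (k n.+1))
    = circle_shift (g n) f (proj s n).
Proof.
move=> cg ft fb n; have [i [ci [x [_ ->]]]] := threadP s.
rewrite !thread_proj !circle_shiftE //.
rewrite (@circle_coverE _ L (p n) (k n) (rot (g n.+1) (i n.+1))).
congr circle_pt; apply: ord_inj => /=.
by rewrite (modn_dvdm _ (compatible_dvd n)) -modnDm ci cg.
Qed.

Definition shift g (cg : compatible g) f (ft : f top = top) (fb : f bot = bot)
    (s : S) : S :=
  SigSub (mem_set (circle_shift_cover s cg ft fb)
    : (fun n => circle_shift (g n) f (proj s n)) \in _).

Lemma shift_projE g (cg : compatible g) f ft fb s n :
  proj (@shift g cg f ft fb s) n = circle_shift (g n) f (proj s n).
Proof. by []. Qed.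

Lemma shift_proj g (cg : compatible g) f ft fb i (ci : compatible i) x n :
  proj (@shift g cg f ft fb (thread ci x)) n = circle_pt (rot (g n) (i n)) (f x).
Proof. by rewrite shift_projE thread_proj circle_shiftE. Qed.

Lemma shift_continuous g (cg : compatible g) f ft fb :
  continuous f -> continuous (@shift g cg f ft fb).
Proof.
move=> fc; apply: solenoid_continuous => n.
rewrite (_ : (fun s => _) = circle_shift (g n) f \o (fun s => proj s n)); last first.
  by apply/funext => s; rewrite shift_projE.
move=> s; apply: continuous_comp; first exact: proj_solenoid_continuous.
exact: circle_shift_continuous.
Qed.

Definition opp_family g n : 'I_(k n) :=
  Ordinal (ltn_pmod (k n - g n) (degree_gt0 n)).

Lemma opp_compatible g : compatible g -> compatible (opp_family g).
Proof.
move=> cg n; rewrite [LHS](modn_dvdm _ (compatible_dvd n)) /=.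
apply/eqP; rewrite -(eqn_modDr (g n.+1)) subnK ?(ltnW (ltn_ord _)) //.
rewrite -modnDmr cg subnK ?(ltnW (ltn_ord _)) // modnn.
exact: compatible_dvd.
Qed.

Lemma rot_opp g n (i : 'I_(k n)) : rot (opp_family g n) (rot (g n) i) = i.
Proof.
apply: ord_inj; rewrite rotD /= addnA modnDmr.
by rewrite -addnA subnKC ?(ltnW (ltn_ord _)) // modnDr modn_small.
Qed.

Lemma rot_oppK g n (i : 'I_(k n)) : rot (g n) (rot (opp_family g n) i) = i.
Proof. by rewrite rotD addnC -rotD rot_opp. Qed.

(** The automorphisms of [L] act on the solenoid, and so do the deck
    transformations, which are transitive on each fibre. *)
Lemma shift_homeomorphism g (cg : compatible g) f f' ft fb :
  continuous f -> continuous f' -> cancel f f' -> cancel f' f ->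
  Defs.homeomorphism (@shift g cg f ft fb).
Proof.
move=> fc f'c ff' f'f; split; first exact: shift_continuous.
have f't : f' top = top by rewrite -{1}ft ff'.
have f'b : f' bot = bot by rewrite -{1}fb ff'.
exists (shift (opp_compatible cg) f't f'b); split.
- exact: shift_continuous.
- move=> s; have [i [ci [x [_ ->]]]] := threadP s; apply: solenoid_eq => n.
  rewrite !shift_projE thread_proj.
  by rewrite !circle_shiftE // rot_opp ff'.
- move=> s; have [i [ci [x [_ ->]]]] := threadP s; apply: solenoid_eq => n.
  rewrite !shift_projE thread_proj.
  by rewrite !circle_shiftE // rot_oppK f'f.
Qed.

Definition zero_family n : 'I_(k n) := Ordinal (degree_gt0 n).

Lemma zero_compatible : compatible zero_family.
Proof. by move=> n; rewrite /= mod0n. Qed.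

Lemma thread_orbit f f' i (ci : compatible i) x :
  f top = top -> f bot = bot ->
  continuous f -> continuous f' -> cancel f f' -> cancel f' f ->
  homeo_orbit (thread ci x) (thread zero_compatible (f x)).
Proof.
move=> ft fb fc f'c ff' f'f.
exists (shift (opp_compatible ci) ft fb).
  exact: shift_homeomorphism fc f'c ff' f'f.
apply: solenoid_eq => n; rewrite shift_proj thread_proj; congr circle_pt.
apply: ord_inj; rewrite /= modnDmr subnKC ?modnn //.
exact: ltnW.
Qed.
End solenoids.

(** * Arcs in ordered continua *)

Section intervals.
Context d (L : orderTopologicalType d) (bot top : L).
Hypothesis bot_min : forall x, bot <= x.
Hypothesis top_max : forall x, x <= top.
Hypothesis bot_top : bot != top.
Hypothesis L_sup : forall A : set L, exists s,
  (forall x, A x -> x <= s) /\ forall u, (forall x, A x -> x <= u) -> s <= u.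
Hypothesis L_dense : forall x y : L, x < y -> exists2 z, x < z & z < y.

Lemma open_left (A : set L) x : open A -> A x -> bot < x ->
  exists2 q, q < x & forall y, q < y -> y <= x -> A y.
Proof.
move=> Ao Ax bx; have : nbhs x A by apply: open_nbhs_nbhs; split.
rewrite itv_nbhsE => -[[l r] [lro xlr] lrA].
have rP y : y <= x -> BRight y <= r.
  by move: xlr; rewrite itv_boundlr => /andP[_ xr] yx; apply: le_trans xr.
have lP : l <= BLeft x by move: xlr; rewrite itv_boundlr => /andP[].
case: l => [b q|[]] in lro xlr lrA lP.
- rewrite (itv_open_ends_lside lro) in lrA lP; exists q => // y qy yx.
  by apply: lrA; rewrite /= itv_boundlr rP // andbT.
- exists bot => // y _ yx.
  by apply: lrA; rewrite /= itv_boundlr rP // andbT.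
- by [].
Qed.

Lemma open_right (A : set L) x : open A -> A x -> x < top ->
  exists2 q, x < q & forall y, x <= y -> y < q -> A y.
Proof.
move=> Ao Ax bx; have : nbhs x A by apply: open_nbhs_nbhs; split.
rewrite itv_nbhsE => -[[l r] [lro xlr] lrA].
have lP y : x <= y -> l <= BLeft y.
  by move: xlr; rewrite itv_boundlr => /andP[lx _] xy; apply: (le_trans lx).
have rP : BRight x <= r by move: xlr; rewrite itv_boundlr => /andP[].
case: r => [b q|[]] in lro xlr lrA rP.
- rewrite (itv_open_ends_rside lro) in lrA rP; exists q => // y xy yq.
  by apply: lrA; rewrite /= itv_boundlr lP.
- by [].
- exists top => // y xy _.
  by apply: lrA; rewrite /= itv_boundlr lP.
Qed.

(** Connectedness of closed intervals: at the supremum of the points up to which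
    the interval lies in [A], both [A] and [B] are met. *)
Lemma itv_connected (A B : set L) x y : open A -> open B -> x <= y -> A x -> B y ->
  (forall z, x <= z -> z <= y -> A z \/ B z) ->
  exists z, [/\ x <= z, z <= y, A z & B z].
Proof.
move=> Ao Bo xy Ax By AB.
pose C := [set t | [/\ x <= t, t <= y & forall u, x <= u -> u <= t -> A u]].
have Cx : C x.
  by split=> // u xu ux; rewrite (_ : u = x) //; apply/eqP; rewrite eq_le xu ux.
have [s [sub slub]] := L_sup C.
have xs : x <= s by exact: sub.
have sy : s <= y by apply: slub => t [].
have Cs u : x <= u -> u < s -> A u.
  move=> xu us; have [[t [Ct ut]]|/forallNP nt] := pselect (exists t, C t /\ u <= t).
    by have [_ _] := Ct; exact.
  have : s <= u.
    by apply: slub => t Ct; rewrite leNgt; apply/negP => /ltW ut; apply: (nt t).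
  by rewrite leNgt us.
have [As|nAs] := pselect (A s).
  have [yE|ys] := eqVneq s y; first by exists s; split=> //; rewrite yE.
  have lsy : s < y by rewrite lt_neqAle ys sy.
  have [q sq qA] := open_right Ao As (lt_le_trans lsy (top_max y)).
  have [t st tq] : exists2 t, s < t & t < Order.min q y.
    by apply: L_dense; rewrite lt_min sq lsy.
  move: tq; rewrite lt_min => /andP[tq ty].
  suff /sub : C t by rewrite leNgt st.
  split; [exact: le_trans xs (ltW st)|exact: ltW|move=> u xu ut].
  have [us|su] := ltP u s; first exact: Cs.
  by apply: qA => //; exact: le_lt_trans tq.
have Bs : B s by have [] := AB _ xs sy.
have lxs : x < s.
  by rewrite lt_neqAle xs andbT; apply/eqP => xE; apply: nAs; rewrite -xE.
have [q qs qB] := open_left Bo Bs (le_lt_trans (bot_min x) lxs).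
have [t tq ts] : exists2 t, Order.max q x < t & t < s.
  by apply: L_dense; rewrite gt_max qs lxs.
move: tq; rewrite gt_max => /andP[qt xt].
exists t; split; [exact: ltW|exact: le_trans (ltW ts) sy| |].
  by apply: Cs => //; exact: ltW.
by apply: qB => //; exact: ltW.
Qed.

(* [R] stands for the order of [L] or its reverse, so that peaks and valleys are
   treated at once. *)
Section injective_maps.
Context (q a : L) (f : L -> L) (R : L -> L -> Prop).
Hypothesis f_inj : forall x y, q <= x <= a -> q <= y <= a -> f x = f y -> x = y.
Hypothesis ivt : forall x y v, q <= x -> x <= y -> y <= a ->
  (R (f x) v /\ R v (f y)) \/ (R (f y) v /\ R v (f x)) ->
  exists z, [/\ x <= z, z <= y & f z = v].
Hypothesis R_total : forall u v, u <> v -> R u v \/ R v u.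
Hypothesis R_asym : forall u v, R u v -> ~ R v u.

(** At a peak [f y], some value would be taken on both sides of [y]. *)
Lemma no_peak x y z : q <= x -> x < y -> y < z -> z <= a ->
  R (f x) (f y) -> R (f y) (f z).
Proof.
move=> qx xy yz za Rxy.
have xin : q <= x <= a by rewrite qx (le_trans (ltW (lt_trans xy yz))).
have yin : q <= y <= a.
  by rewrite (le_trans qx (ltW xy)) (le_trans (ltW yz)).
have zin : q <= z <= a by rewrite za (le_trans qx (ltW (lt_trans xy yz))).
have xz := lt_trans xy yz.
have [//|Rzy] : R (f y) (f z) \/ R (f z) (f y).
  by apply: R_total => /(f_inj yin zin) yzE; rewrite yzE ltxx in yz.
have [Rxz|Rzx] : R (f x) (f z) \/ R (f z) (f x).
  by apply: R_total => /(f_inj xin zin) xzE; rewrite xzE ltxx in xz.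
- have ya : y <= a by case/andP: yin.
  have [t [xt ty tz]] := ivt qx (ltW xy) ya (or_introl (conj Rxz Rzy)).
  have tin : q <= t <= a by rewrite (le_trans qx xt) (le_trans ty).
  by move: (le_lt_trans ty yz); rewrite (f_inj tin zin tz) ltxx.
- have qy : q <= y by case/andP: yin.
  have [t [yt tz tx]] := ivt qy (ltW yz) za (or_intror (conj Rzx Rxy)).
  have tin : q <= t <= a by rewrite (le_trans tz za) (le_trans qy).
  by move: (lt_le_trans xy yt); rewrite (f_inj tin xin tx) ltxx.
Qed.

End injective_maps.

Lemma injective_monotone (q a : L) (f : L -> L) (R : L -> L -> Prop) :
  (forall x y, q <= x <= a -> q <= y <= a -> f x = f y -> x = y) ->
  (forall x y v, q <= x -> x <= y -> y <= a ->
    (R (f x) v /\ R v (f y)) \/ (R (f y) v /\ R v (f x)) ->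
    exists z, [/\ x <= z, z <= y & f z = v]) ->
  (forall u v, u <> v -> R u v \/ R v u) -> (forall u v, R u v -> ~ R v u) ->
  (forall u v w, R u v -> R v w -> R u w) -> q < a -> R (f q) (f a) ->
  forall x y, q <= x -> x < y -> y <= a -> R (f x) (f y).
Proof.
move=> f_inj ivt R_total R_asym R_trans qa Rqa.
have Rq y : q < y -> y <= a -> R (f q) (f y).
  rewrite le_eqVlt => qy /predU1P[-> //|ya].
  have [//|Ryq] : R (f q) (f y) \/ R (f y) (f q).
    apply: R_total => E; move: (qy); rewrite (f_inj q y) ?ltxx //.
      by rewrite lexx ltW.
    by rewrite !ltW.
  suff /(R_trans _ _ _ Rqa)/R_asym : R (f a) (f y) by [].
  apply: (@no_peak q a f (fun u v => R v u) f_inj _ _ q y a) => //.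
    move=> x z v qx xz za H; apply: ivt => //.
    by case: H => -[? ?]; [right|left]; split.
  by move=> u v uv; have [] := R_total _ _ uv; [right|left].
move=> x y; rewrite le_eqVlt => /predU1P[<-|qx] xy ya; first exact: Rq.
apply: (@no_peak q a f R f_inj ivt R_total q x y) => //.
by apply: Rq => //; exact: le_trans (ltW xy) ya.
Qed.

Section local_maps.
Context (p : nat -> nat).
Local Notation k := (degree p).
Local Notation S := (solenoid L p).
Local Notation proj s n := (set_val (s : S) n : circle L (k n)).

(** A homeomorphism maps a short arc through an interior point into one thread,
    since the other threads that it could reach are separated from that one in
    some circle. *)
Lemma thread_local_map (h : S -> S) i (ci : compatible (p := p) i) j
    (cj : compatible (p := p) j) a b :
  continuous h -> injective h -> bot < a < top -> bot < b < top ->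
  h (thread ci a) = thread cj b ->
  exists q f, [/\ q < a, f a = b &
    (forall x y, q <= x -> x < y -> y <= a -> f x < f y) \/
    (forall x y, q <= x -> x < y -> y <= a -> f y < f x)].
Proof.
move=> hc hi /andP[ba at_] /andP[bb bt] hab.
have /choice[r rP] : forall x, exists r : (forall n, 'I_(k n)) * L,
    r.2 != top /\ forall n, proj (h (thread ci x)) n = circle_pt (r.1 n) r.2.
  move=> x; have [e [ce [y [yt hE]]]] :=
    threadP bot_min top_max bot_top (h (thread ci x)).
  by exists (e, y); split=> // n; rewrite hE thread_proj.
pose f x := (r x).2; pose e x n := (r x).1 n.
have ft x : f x != top by have [] := rP x.
have hE x n : proj (h (thread ci x)) n = circle_pt (e x n) (f x).
  by have [_] := rP x.
have neq_top x : x < top -> x != top by rewrite lt_neqAle => /andP[].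
have [ea fa] : (forall n, e a n = j n) /\ f a = b.
  have E n : e a n = j n /\ f a = b.
    apply: (circle_pt_inj bot_min top_max bot_top) => //; first exact: neq_top.
    by rewrite -hE hab thread_proj.
  by split=> [n|]; [have [] := E n|have [] := E 0%N].
have openV n (c : 'I_(k n)) U : open U -> ~ U bot -> ~ U top ->
    open [set x | e x n = c /\ U (f x)].
  move=> Uo Ub Ut.
  have hpc : continuous (fun x => proj (h (thread ci x)) n).
    move=> x; apply: (@continuous_comp L S _ (h \o thread ci) (fun s => proj s n)).
      apply: continuous_comp; last exact: hc.
      exact: thread_continuous.
    exact: proj_solenoid_continuous.
  have := circle_pt_preimage_open bot_min top_max bot_top c hpc Uo Ub Ut.
  congr open; apply/seteqP; split=> x /=; rewrite hE.
    by move/(circle_pt_image bot_min top_max bot_top _ _ _ Ub Ut).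
  by move=> H; apply/(circle_pt_image bot_min top_max bot_top _ _ _ Ub Ut).
pose I := `]bot, top[%classic : set L.
have IE x : I x <-> bot < x < top by rewrite /I /= in_itv.
have openVI n (c : 'I_(k n)) U : open U -> open [set x | e x n = c /\ (U `&` I)%classic (f x)].
  move=> Uo; apply: openV => [|[_ /IE]|[_ /IE]].
  - by apply: openI => //; exact: itv_open.
  - by rewrite ltxx.
  - by rewrite ltxx andbF.
have Ia : I (f a) by apply/IE; rewrite fa bb.
have [q0 q0a q0I] := open_left (openVI 0%N (e a 0%N) setT openT)
  (conj erefl (conj Logic.I Ia)) ba.
have [q q0q qa] := L_dense q0a.
have If x : q <= x -> x <= a -> I (f x).
  by move=> qx xa; have [_ []] := q0I x (lt_le_trans q0q qx) xa.
have ef x : q <= x -> x <= a -> forall n, e x n = e a n.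
  move=> qx xa n; apply: contrapT => nex.
  pose A := \bigcup_(c in [set c | c <> e a n])
    [set x | e x n = c /\ (setT `&` I)%classic (f x)].
  have Ao : open A by apply: bigcup_open => c _; exact: openVI openT.
  have Ax : A x by exists (e x n) => //; split=> //; split=> //; exact: If.
  have [||z [_ _ [c cn [ez _]] [ez' _]]] :=
      itv_connected Ao (openVI n (e a n) setT openT) xa Ax.
  - by split=> //; split.
  - move=> z xz za; have Iz := If z (le_trans qx xz) za.
    have [ez|ez] := pselect (e z n = e a n); first by right; split.
    by left; exists (e z n).
  - by apply: cn; rewrite -ez.
have f_inj x y : q <= x <= a -> q <= y <= a -> f x = f y -> x = y.
  move=> /andP[qx xa] /andP[qy ya] fxy.
  have /hi E : h (thread ci x) = h (thread ci y).
    by apply: solenoid_eq => n; rewrite !hE fxy (ef x) // (ef y).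
  have : proj (thread ci x) 0%N = proj (thread ci y) 0%N by rewrite E.
  rewrite !thread_proj => /(circle_pt_inj bot_min top_max bot_top)[] //.
  - exact/neq_top/(le_lt_trans xa).
  - exact/neq_top/(le_lt_trans ya).
have ivt0 x y v : q <= x -> x <= y -> y <= a ->
    (f x < v /\ v < f y) \/ (f y < v /\ v < f x) ->
    exists z, [/\ x <= z, z <= y & f z = v].
  move=> qx xy ya H; apply: contrapT => nz.
  pose A := [set x | e x 0%N = e a 0%N /\ (`]-oo, v[ `&` I)%classic (f x)].
  pose B := [set x | e x 0%N = e a 0%N /\ (`]v, +oo[ `&` I)%classic (f x)].
  have Ao : open A by apply: openVI; exact: lray_open.
  have Bo : open B by apply: openVI; exact: rray_open.
  have AE z : x <= z -> z <= y -> f z < v -> A z.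
    move=> xz zy zv; have [qz za] := (le_trans qx xz, le_trans zy ya).
    by split; [exact: ef|split; [rewrite /= in_itv|exact: If]].
  have BE z : x <= z -> z <= y -> v < f z -> B z.
    move=> xz zy zv; have [qz za] := (le_trans qx xz, le_trans zy ya).
    by split; [exact: ef|split; [rewrite /= in_itv /= andbT|exact: If]].
  have nAB z : A z -> B z -> False.
    move=> [_ [+ _]] [_ [+ _]]; rewrite /= !in_itv /= andbT => zv vz.
    by have := lt_trans zv vz; rewrite ltxx.
  have AB z : x <= z -> z <= y -> A z \/ B z.
    move=> xz zy; case: (ltgtP (f z) v) => [zv|vz|zv]; [left|right|].
    - exact: AE.
    - exact: BE.
    - by case: nz; exists z.
  case: H => -[xv vy].
    have [z [_ _ Az]] := itv_connected Ao Bo xy (AE _ (lexx x) xy xv)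
      (BE _ xy (lexx y) vy) AB.
    exact: nAB.
  have [|z [_ _ Bz Az]] := itv_connected Bo Ao xy (BE _ (lexx x) xy vy)
      (AE _ xy (lexx y) xv).
    by move=> z xz zy; apply/or_comm; exact: AB.
  exact: nAB Az Bz.
exists q, f; split=> //.
have fqa : f q <> f a.
  move=> fqa; have E : q = a by apply: f_inj => //; rewrite lexx ltW.
  by move: qa; rewrite E ltxx.
case: (ltgtP (f q) (f a)) => [lt_qa|lt_aq|//]; [left|right].
- apply: (@injective_monotone q a f (fun u v => u < v)) => //.
  + by move=> u v /eqP; rewrite neq_lt => /orP.
  + by move=> u v uv vu; have := lt_trans uv vu; rewrite ltxx.
  + by move=> u v w; exact: lt_trans.
- apply: (@injective_monotone q a f (fun u v => v < u)) => //.
  + by move=> x y v qx xy ya H; apply: ivt0 => //; case: H => -[? ?]; [right|left]; split.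
  + by move=> u v /eqP; rewrite neq_lt => /orP/or_comm.
  + by move=> u v uv vu; have := lt_trans uv vu; rewrite ltxx.
  + by move=> u v w uv vw; exact: lt_trans uv.
Qed.
End local_maps.
End intervals.

(** * Closed long lines *)

Section long_line.
Context (R : realType) (D : ord).
Local Notation L := (closed_long_line R D).

Definition line_pt (a : D) (t : unit_co R) : L := Some (a, t).
Definition line_end : L := None.

Lemma line_end_max (x : L) : x <= line_end.
Proof. by case: x. Qed.

Lemma line_end_lt (x : L) : (line_end < x) = false.
Proof. by rewrite (@ltNge _ L) line_end_max. Qed.

Lemma line_ptP (x : L) : x = line_end \/ exists a t, x = line_pt a t.
Proof. by case: x => [[a t]|]; [right; exists a, t|left]. Qed.

Lemma line_pt_le a s b t :
  (line_pt a s <= line_pt b t) = (a < b) || ((a == b) && (s <= t)).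
Proof.
have -> : (line_pt a s <= line_pt b t) = (((a, s) : D *l unit_co R) <= (b, t)) by [].
by rewrite leEprodlexi /=; case: (ltgtP a b).
Qed.

Lemma line_pt_lt a s b t :
  (line_pt a s < line_pt b t) = (a < b) || ((a == b) && (s < t)).
Proof.
rewrite [LHS](@ltNge _ L) line_pt_le negb_or negb_and -leNgt -ltNge eq_sym.
by case: (ltgtP a b).
Qed.

Lemma line_pt_lt_end a t : line_pt a t < line_end.
Proof. by []. Qed.

Definition unit_co_of (t : R) (t01 : (0 <= t < 1)%R) : unit_co R := exist _ t t01.

Definition frac (t : unit_co R) : R := val t.

Lemma frac_of t (t01 : (0 <= t < 1)%R) : frac (unit_co_of t01) = t.
Proof. by []. Qed.

Lemma unit_co_le (s t : unit_co R) : (s <= t) = (frac s <= frac t)%R.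
Proof. by rewrite -Order.le_val. Qed.

Lemma unit_co_lt (s t : unit_co R) : (s < t) = (frac s < frac t)%R.
Proof. by rewrite !ltNge unit_co_le. Qed.

Lemma unit_co_bound (t : unit_co R) : (0 <= frac t)%R /\ (frac t < 1)%R.
Proof. by apply/andP; exact: valP t. Qed.

Lemma unit_co_dense (s t : unit_co R) : s < t -> exists2 r, s < r & r < t.
Proof.
rewrite unit_co_lt => st; have [s0 s1] := unit_co_bound s.
have [t0 t1] := unit_co_bound t.
have r01 : (0 <= (frac s + frac t) / 2 < 1)%R by apply/andP; split; lra.
by exists (unit_co_of r01); rewrite unit_co_lt frac_of; lra.
Qed.

Lemma unit_co_nomax (s : unit_co R) : exists r, s < r.
Proof.
have [s0 s1] := unit_co_bound s.
have r01 : (0 <= (frac s + 1) / 2 < 1)%R by apply/andP; split; lra.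
by exists (unit_co_of r01); rewrite unit_co_lt frac_of; lra.
Qed.

Lemma line_dense (x y : L) : x < y -> exists2 z, x < z & z < y.
Proof.
have [->|[a [s ->]]] := line_ptP x; first by rewrite ltNge line_end_max.
have [r sr] := unit_co_nomax s.
have xr : line_pt a s < line_pt a r by rewrite line_pt_lt eqxx sr orbT.
have [->|[b [t ->]]] := line_ptP y; first by exists (line_pt a r).
rewrite line_pt_lt => /orP[ab|/andP[/eqP <- st]].
  by exists (line_pt a r) => //; rewrite line_pt_lt ab.
have [u su ut] := unit_co_dense st.
by exists (line_pt a u); rewrite line_pt_lt eqxx /= ?su ?ut orbT.
Qed.

(** The supremum of a set lies over the least ordinal over which some upper
    bound lies. *)
Lemma line_sup (A : set L) : exists s,
  (forall x, A x -> x <= s) /\ forall u, (forall x, A x -> x <= u) -> s <= u.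
Proof.
pose ub (u : L) := forall x, A x -> x <= u.
have [[a [t0 at0]]|noub] := pselect (exists a t, ub (line_pt a t)); last first.
  exists line_end; split=> [x _|u uub]; first exact: line_end_max.
  have [->//|[a [t ut]]] := line_ptP u.
  by case: noub; exists a, t; rewrite -ut.
have [|b [t1 bt1] bmin] := @ord_least D [set b | exists t, ub (line_pt b t)].
  by exists a, t0.
pose T := [set frac t | t in [set t : unit_co R | ub (line_pt b t)]].
have T0 : T !=set0 by exists (frac t1), t1.
have lbT : lbound T 0%R by move=> _ [t _ <-]; have [] := unit_co_bound t.
have hT : has_inf T by split=> //; exists 0%R.
have i01 : (0 <= inf T < 1)%R.
  rewrite lb_le_inf //=; have [_] := unit_co_bound t1; apply: le_lt_trans.
  by apply: ge_inf; [exists 0%R|exists t1].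
exists (line_pt b (unit_co_of i01)); split=> [x Ax|u uub].
  have [xE|[c [s xE]]] := line_ptP x.
    by have := bt1 _ Ax; rewrite xE leNgt line_pt_lt_end.
  have := bt1 _ Ax; rewrite xE !line_pt_le => /orP[->//|/andP[/eqP cb _]].
  rewrite cb eqxx unit_co_le /= orbC /= lb_le_inf // => _ [t tub <-].
  by have := tub _ Ax; rewrite xE cb line_pt_le ltxx eqxx unit_co_le.
have [->|[c [t uE]]] := line_ptP u; first exact: line_end_max.
have : b <= c by apply: bmin; exists t; rewrite -uE.
rewrite uE line_pt_le le_eqVlt => /predU1P[bc|->//].
rewrite bc eqxx unit_co_le /=; apply/orP; right.
by apply: ge_inf; [exists 0%R|exists t => //=; rewrite bc -uE].
Qed.

Lemma line_inf (A : set L) : exists s,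
  (forall x, A x -> s <= x) /\ forall u, (forall x, A x -> u <= x) -> u <= s.
Proof.
have [s [sub slub]] := line_sup [set u | forall x, A x -> u <= x].
by exists s; split=> [x Ax|u]; [apply: slub => u; exact|exact: sub].
Qed.
End long_line.

(** * Extending automorphisms of a convex part *)

Lemma order_iso_continuous d (L : orderTopologicalType d) (f g : L -> L) :
  {homo f : x y / x < y} -> {homo g : x y / x < y} -> cancel f g -> cancel g f ->
  continuous f.
Proof.
move=> fh gh fg gf x U; rewrite itv_nbhsE => -[[l r] [lro fxlr] lrU].
have fm := le_mono fh.
have gle z y : (g z <= y) = (z <= f y) by rewrite -fm gf.
have glt z y : (g z < y) = (z < f y) by rewrite -(leW_mono fm) gf.
have leg z y : (y <= g z) = (f y <= z) by rewrite -fm gf.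
have ltg z y : (y < g z) = (f y < z) by rewrite -(leW_mono fm) gf.
pose m (b : itv_bound L) := match b with BSide c y => BSide c (g y) | b => b end.
have mE y : (y \in Interval (m l) (m r)) = (f y \in Interval l r).
  rewrite !itv_boundlr; congr andb.
    by case: (l) => [[] z|[]]; rewrite /m ?bnd_simp ?gle ?glt.
  by case: (r) => [[] z|[]]; rewrite /m ?bnd_simp ?leg ?ltg.
rewrite /= nbhs_simpl /= itv_nbhsE; exists (Interval (m l) (m r)).
  by split; [move: lro; case: (l) (r) => [[] ?|[]] [[] ?|[]]|rewrite mE].
by move=> y; rewrite /= mE => /lrU.
Qed.

Section patching.
Context d (L : orderType d) (B : set L).
Hypothesis B_convex : forall x y z, B x -> B z -> x < y -> y < z -> B y.

Definition patch_map (g : L -> L) x := if pselect (B x) then g x else x.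

Lemma patch_map_in g x : B x -> patch_map g x = g x.
Proof. by rewrite /patch_map; case: pselect. Qed.

Lemma patch_map_out g x : ~ B x -> patch_map g x = x.
Proof. by rewrite /patch_map; case: pselect. Qed.

Lemma patch_map_homo g : (forall x, B x -> B (g x)) ->
  (forall x y, B x -> B y -> x < y -> g x < g y) ->
  {homo patch_map g : x y / x < y}.
Proof.
move=> gB gh x y xy.
have [Bx|nBx] := pselect (B x); have [By|nBy] := pselect (B y).
- by rewrite !patch_map_in //; exact: gh.
- rewrite patch_map_in // patch_map_out //; rewrite ltNge; apply/negP.
  rewrite le_eqVlt => /predU1P[yE|ygx]; first by apply: nBy; rewrite yE; exact: gB.
  by apply: nBy; apply: B_convex xy ygx => //; exact: gB.
- rewrite patch_map_out // patch_map_in //; rewrite ltNge; apply/negP.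
  rewrite le_eqVlt => /predU1P[xE|gyx]; first by apply: nBx; rewrite -xE; exact: gB.
  by apply: nBx; apply: B_convex gyx xy => //; exact: gB.
- by rewrite !patch_map_out.
Qed.

Lemma patch_mapK g g' : (forall x, B x -> B (g x)) ->
  (forall x, B x -> g' (g x) = x) -> cancel (patch_map g) (patch_map g').
Proof.
move=> gB gg' x; have [Bx|nBx] := pselect (B x).
  by rewrite (patch_map_in g) // patch_map_in ?gg' //; exact: gB.
by rewrite !patch_map_out.
Qed.
End patching.

Section interval_automorphism.
Context (R : realType) (M : R).
Local Open Scope ring_scope.

(** The piecewise linear automorphism of [[0, M[] that maps [u] to [v]. *)
Definition bend (u v s : R) :=
  if s <= u then s * (v / u) else M - (M - s) * ((M - v) / (M - u)).

Lemma bendK u v s : 0 < u < M -> 0 < v < M -> bend v u (bend u v s) = s.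
Proof.
move=> /andP[u0 uM] /andP[v0 vM]; rewrite /bend.
have [su|us] := leP s u.
  have -> : s * (v / u) <= v.
    rewrite mulrA ler_pdivrMr // mulrC; apply: ler_wpM2l su; exact: ltW.
  by field; apply/andP; split; rewrite gt_eqF.
have -> : (M - (M - s) * ((M - v) / (M - u)) <= v) = false.
  apply/negbTE; rewrite -ltNge ltrBrDl -ltrBrDr mulrA ltr_pdivrMr ?subr_gt0 //.
  by rewrite mulrC ltr_pM2l ?subr_gt0 // ltrD2l ltrN2.
field; apply/andP; split; rewrite subr_eq0 gt_eqF //.
Qed.

Lemma bend_lt u v : 0 < u < M -> 0 < v < M -> {homo bend u v : s t / s < t}.
Proof.
move=> /andP[u0 uM] /andP[v0 vM] s t st; rewrite /bend.
have vu : 0 < v / u by rewrite divr_gt0.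
have vu' : 0 < (M - v) / (M - u) by rewrite divr_gt0 // subr_gt0.
have vuE : u * (v / u) = v by field; rewrite gt_eqF.
have vuE' : (M - u) * ((M - v) / (M - u)) = M - v.
  by field; rewrite subr_eq0 gt_eqF.
have [su|us] := leP s u; have [tu|ut] := leP t u.
- by rewrite ltr_pM2r.
- have H1 : s * (v / u) <= v by rewrite -[X in _ <= X]vuE ler_pM2r.
  have H2 : (M - t) * ((M - v) / (M - u)) < M - v.
    by rewrite -[X in _ < X]vuE' ltr_pM2r //; lra.
  by lra.
- by lra.
- have H : (M - t) * ((M - v) / (M - u)) < (M - s) * ((M - v) / (M - u)).
    by rewrite ltr_pM2r //; lra.
  by lra.
Qed.

Lemma bend0 u v : 0 < u -> bend u v 0 = 0.
Proof. by move=> u0; rewrite /bend ltW // mul0r. Qed.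

Lemma bendM u v : 0 < u < M -> bend u v M = M.
Proof.
by move=> /andP[_ uM]; rewrite /bend leNgt uM /= subrr mul0r subr0.
Qed.

Lemma bend_eq u v : 0 < u -> bend u v u = v.
Proof. by move=> u0; rewrite /bend lexx; field; rewrite gt_eqF. Qed.

Lemma bend_itv u v s : 0 < u < M -> 0 < v < M -> 0 <= s < M -> 0 <= bend u v s < M.
Proof.
move=> uM vM /andP[s0 sM]; have bh := bend_lt uM vM; have bm := le_mono bh.
have /andP[u0 _] := uM.
by rewrite -{1}(bend0 v u0) bm s0 /= -[X in _ < X](bendM v uM) bh.
Qed.
End interval_automorphism.

(** Transport a piecewise linear automorphism of the real interval by [phi], and
    extend it by the identity. *)
Lemma block_homogeneous d (L : orderType d) (R : realType) (B : set L)
    (phi : L -> R) (M : R) (x y : L) :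
  (forall x y z, B x -> B z -> x < y -> y < z -> B y) ->
  (forall x y, B x -> B y -> x < y -> (phi x < phi y)%R) ->
  (forall x, B x -> (0 <= phi x < M)%R) ->
  (forall s, (0 <= s < M)%R -> exists2 x, B x & phi x = s) ->
  B x -> B y -> phi x != 0%R -> phi y != 0%R ->
  exists f g : L -> L, [/\ {homo f : x y / x < y}, {homo g : x y / x < y},
    cancel f g, cancel g f & f x = y].
Proof.
move=> Bc ph pM ps Bx By px0 py0.
have /choice[psi psiP] : forall s, exists x, (0 <= s < M)%R -> B x /\ phi x = s.
  move=> s; have [/ps[z Bz zs]|ns] := pselect (0 <= s < M)%R; first by exists z.
  by exists x.
have phi_inj z t : B z -> B t -> phi z = phi t -> z = t.
  move=> Bz Bt E; case: (ltgtP z t) => [/(ph _ _ Bz Bt)|/(ph _ _ Bt Bz)|//];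
    by rewrite E ltxx.
have pos z : B z -> phi z != 0%R -> (0 < phi z < M)%R.
  by move=> /pM/andP[z0 zM] nz; rewrite lt_neqAle eq_sym nz z0.
have uM := pos _ Bx px0; have vM := pos _ By py0.
pose g u v z := psi (bend M u v (phi z)).
have gP u v z : (0 < u < M)%R -> (0 < v < M)%R -> B z ->
    B (g u v z) /\ phi (g u v z) = bend M u v (phi z).
  by move=> u0 v0 /pM zM; apply: psiP; exact: bend_itv.
have gh u v z t : (0 < u < M)%R -> (0 < v < M)%R -> B z -> B t -> z < t ->
    g u v z < g u v t.
  move=> u0 v0 Bz Bt zt; have [Bgz gz] := gP _ _ _ u0 v0 Bz.
  have [Bgt gt] := gP _ _ _ u0 v0 Bt.
  have : (phi (g u v z) < phi (g u v t))%R.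
    by rewrite gz gt; apply: bend_lt => //; exact: ph.
  case: (ltgtP (g u v z) (g u v t)) => [//|/(ph _ _ Bgt Bgz) lt_tz|->].
    by rewrite ltNge (ltW lt_tz).
  by rewrite ltxx.
have gK u v z : (0 < u < M)%R -> (0 < v < M)%R -> B z -> g v u (g u v z) = z.
  move=> u0 v0 Bz; have [Bgz gz] := gP _ _ _ u0 v0 Bz.
  have [Bggz ggz] := gP _ _ _ v0 u0 Bgz.
  by apply: phi_inj => //; rewrite ggz gz bendK.
exists (patch_map B (g (phi x) (phi y))), (patch_map B (g (phi y) (phi x))).
split.
- by apply: patch_map_homo => // [z /(gP _ _ _ uM vM)[]//|z t]; exact: gh.
- by apply: patch_map_homo => // [z /(gP _ _ _ vM uM)[]//|z t]; exact: gh.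
- by apply: patch_mapK => z Bz; [have [] := gP _ _ _ uM vM Bz|exact: gK].
- by apply: patch_mapK => z Bz; [have [] := gP _ _ _ vM uM Bz|exact: gK].
- rewrite patch_map_in //; have [Bg gx] := gP _ _ _ uM vM Bx.
  by apply: phi_inj => //; rewrite gx bend_eq //; case/andP: uM.
Qed.

(** * Real coordinates on countable long lines *)

Section weights.
Context (R : realType).
Local Open Scope ring_scope.

Definition mass (i : nat) : R := 2^-1 ^+ i.+1.

Definition partial_weight (P : set nat) n : R :=
  \sum_(i < n) (if `[< P i >] then mass i else 0).

Definition weight (P : set nat) : R := sup [set partial_weight P n | n in setT].

Lemma mass_gt0 i : 0 < mass i.
Proof. by rewrite exprn_gt0 // invr_gt0. Qed.

Lemma partial_weightS P n : partial_weight P n.+1 =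
  partial_weight P n + (if `[< P n >] then mass n else 0).
Proof. by rewrite /partial_weight big_ord_recr. Qed.

Lemma partial_weight_le1 P n : partial_weight P n <= 1.
Proof.
suff : partial_weight P n <= 1 - 2^-1 ^+ n.
  by move/le_trans; apply; rewrite gerBl exprn_ge0 // invr_ge0.
elim: n => [|n IH]; first by rewrite /partial_weight big_ord0 expr0 subrr.
rewrite partial_weightS.
have := mass_gt0 n; rewrite /mass exprS; case: ifP => _; lra.
Qed.

Lemma partial_weight_has_sup P : has_sup [set partial_weight P n | n in setT].
Proof.
split; first by exists (partial_weight P 0), 0%N.
by exists 1 => _ [n _ <-]; exact: partial_weight_le1.
Qed.

Lemma partial_weight_le P n : partial_weight P n <= weight P.
Proof.
by apply: ub_le_sup; [exact: (partial_weight_has_sup P).2|exists n].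
Qed.

Lemma weight_le P s : (forall n, partial_weight P n <= s) -> weight P <= s.
Proof.
move=> Ps; apply: ge_sup; first exact: (partial_weight_has_sup P).1.
by move=> _ [n _ <-].
Qed.

(** Continuity of [weight]: a partial sum only sees finitely many elements. *)
Lemma weight_approx P s :
  (forall n, exists2 Q, weight Q <= s & forall i, (i < n)%N -> P i -> Q i) ->
  weight P <= s.
Proof.
move=> PQ; apply: weight_le => n; have [Q Qs PQn] := PQ n.
apply: le_trans Qs; apply: le_trans (partial_weight_le Q n).
apply: ler_sum => i _; case: asboolP => [Pi|_].
  by rewrite asboolT //; exact: PQn.
by case: ifP => // _; exact/ltW/mass_gt0.
Qed.

Lemma le_weight P Q : P `<=` Q -> weight P <= weight Q.
Proof. by move=> PQ; apply: weight_approx => n; exists Q => // i _ /PQ. Qed.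

Lemma weight0 : weight set0 = 0.
Proof.
have p0 n : partial_weight set0 n = 0.
  by apply: big1 => i _; rewrite asboolF.
apply/eqP; rewrite eq_le weight_le => [|n]; last by rewrite p0.
by rewrite -(p0 0%N) partial_weight_le.
Qed.

Lemma partial_weight_add P k n : ~ P k -> partial_weight (k |` P) n =
  partial_weight P n + (if (k < n)%N then mass k else 0).
Proof.
move=> nPk; elim: n => [|n IH]; first by rewrite /partial_weight !big_ord0 addr0.
rewrite !partial_weightS IH [in RHS]ltnS [in RHS]leq_eqVlt.
have [E|kn] /= := eqVneq k n.
  rewrite -E ltnn (asboolF nPk) asboolT; last by left.
  by rewrite !addr0.
have -> : `[< (k |` P) n >] = `[< P n >].
  by apply/asbool_equiv_eq; split=> [[/= nk|//]|]; [rewrite nk eqxx in kn|right].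
by rewrite addrAC.
Qed.

Lemma weight_add P k : ~ P k -> weight (k |` P) = weight P + mass k.
Proof.
move=> nPk; apply/eqP; rewrite eq_le; apply/andP; split.
  apply: weight_le => n; rewrite partial_weight_add // lerD ?partial_weight_le //.
  by case: ifP => // _; exact/ltW/mass_gt0.
rewrite -lerBrDr; apply: weight_le => n; rewrite lerBrDr.
apply: (@le_trans _ _ (partial_weight (k |` P) (maxn n k.+1))); last first.
  exact: partial_weight_le.
rewrite partial_weight_add // leq_maxr lerD2r.
rewrite /partial_weight; have nm := leq_maxl n k.+1.
rewrite -(subnKC nm) big_split_ord /= lerDl sumr_ge0 // => i _.
by case: ifP => // _; exact/ltW/mass_gt0.
Qed.
End weights.

(** A coordinate on the long line over the countable ordinal [c1 + 1]: the copy
    of the unit interval after [c] has length [mass (e c)]. *)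
Section coordinates.
Context (R : realType) (A : ord) (c1 : A) (e : A -> nat).
Hypothesis e_inj : forall c c', c <= c1 -> c' <= c1 -> e c = e c' -> c = c'.
Local Open Scope ring_scope.

Definition below (c : A) : set nat := [set e c' | c' in [set c' | (c' < c)%O]].

Definition coord (c : A) (t : unit_co R) : R :=
  weight R (below c) + frac t * mass R (e c).

Definition coord_end : R := weight R (below c1) + mass R (e c1).

Lemma below_self c : (c <= c1)%O -> ~ below c (e c).
Proof.
move=> cc1 [c' c'c /e_inj E]; have := c'c; rewrite /= E ?ltxx //.
exact: le_trans (ltW c'c) cc1.
Qed.

Lemma weight_below c c' : (c < c')%O -> (c' <= c1)%O ->
  weight R (below c) + mass R (e c) <= weight R (below c').
Proof.
move=> cc' c'c1; rewrite -weight_add; last first.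
  exact/below_self/(le_trans (ltW cc')).
apply: le_weight => n [->|[c'' c''c <-]]; first by exists c.
by exists c'' => //; exact: lt_trans cc'.
Qed.

Lemma coord_lt_next c t : coord c t < weight R (below c) + mass R (e c).
Proof.
have [_ t1] := unit_co_bound t.
by rewrite /coord ltrD2l -[X in _ < X]mul1r ltr_pM2r // mass_gt0.
Qed.

Lemma coord_ge c t : weight R (below c) <= coord c t.
Proof.
have [t0 _] := unit_co_bound t.
by rewrite /coord lerDl mulr_ge0 // ltW // mass_gt0.
Qed.

Lemma coord_lt c t c' t' : (c' <= c1)%O ->
  (c < c')%O || ((c == c') && (t < t')%O) -> coord c t < coord c' t'.
Proof.
move=> c'c1 /orP[cc'|/andP[/eqP -> tt']].
  apply: lt_le_trans (coord_lt_next c t) _.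
  exact: le_trans (weight_below cc' c'c1) (coord_ge c' t').
rewrite /coord ltrD2l ltr_pM2r ?mass_gt0 //.
Qed.

Lemma coord_itv c t : (c <= c1)%O -> 0 <= coord c t < coord_end.
Proof.
move=> cc1; apply/andP; split.
  apply: le_trans (coord_ge c t); rewrite -(weight0 R); exact: le_weight.
move: cc1; rewrite le_eqVlt => /predU1P[->|cc1]; first exact: coord_lt_next.
apply: lt_le_trans (coord_lt_next c t) _.
apply: le_trans (weight_below cc1 (lexx c1)) _.
by rewrite lerDl ltW // mass_gt0.
Qed.

(** Take the least [b] whose interval ends after [s]. It begins at or before [s]:
    among finitely many intervals before that of [b], the last one ends at or
    before [s]. *)
Lemma coord_surj s : 0 <= s < coord_end -> exists c t, (c <= c1)%O /\ coord c t = s.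
Proof.
move=> /andP[s0 sM].
have [|b /= bs bmin] := @ord_least A [set b | s < weight R (below b) + mass R (e b)].
  by exists c1.
have bc1 : (b <= c1)%O by exact: bmin.
have bs' : weight R (below b) <= s.
  apply: weight_approx => n.
  have [H|[c [cb H]]] : (forall c', (c' < b)%O -> (n <= e c')%N) \/
      exists c, (c < b)%O /\ forall c', (c' < b)%O -> (e c' < n)%N -> (c' <= c)%O.
    elim: n => [|n [H|[c [cb H]]]]; first by left.
      have [[c [cb cn]]|/forallNP nc] := pselect (exists c, (c < b)%O /\ e c = n).
        right; exists c; split=> // c' c'b; rewrite ltnS leq_eqVlt => /predU1P[E|].
          rewrite (@e_inj c' c) ?E ?cn //; apply: le_trans bc1; exact: ltW.
        by rewrite ltnNge H.
      left=> c' c'b; rewrite ltn_neqAle H // andbT; apply/eqP => E.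
      by apply: (nc c').
    have [[d [db dn]]|/forallNP nc] := pselect (exists c, (c < b)%O /\ e c = n).
      right; exists (Order.max c d); split; first by rewrite gt_max cb.
      move=> c' c'b; rewrite ltnS leq_eqVlt => /predU1P[E|c'n].
        rewrite le_max (@e_inj c' d) ?E ?dn ?lexx ?orbT //;
          apply: le_trans bc1; exact: ltW.
      by rewrite le_max H.
    right; exists c; split=> // c' c'b; rewrite ltnS leq_eqVlt => /predU1P[E|].
      by case: (nc c').
    exact: H.
  - exists set0; first by rewrite weight0.
    by move=> i ilt [c' /H + E]; rewrite E leqNgt ilt.
  - exists (e c |` below c).
      rewrite weight_add; last exact/below_self/(le_trans (ltW cb)).
      by rewrite leNgt; apply/negP => /bmin; rewrite leNgt cb.
    move=> i ilt [c' c'b E]; have := H c' c'b; rewrite E => /(_ ilt).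
    by rewrite le_eqVlt => /predU1P[<-|c'c]; [left|right; exists c'].
have m0 := mass_gt0 R (e b).
have t01 : 0 <= (s - weight R (below b)) / mass R (e b) < 1.
  by rewrite divr_ge0 ?subr_ge0 // ?(ltW m0) //= ltr_pdivrMr // mul1r ltrBlDl.
exists b, (unit_co_of t01); split=> //.
by rewrite /coord frac_of divfK ?gt_eqF // subrKC.
Qed.
End coordinates.

(** * Long lines of length [omega1 * W] *)

(** Otherwise [omega1] would be a countable union of countable segments. *)
Lemma omega1_bounded (I : Type) (g : I -> omega1) :
  injects I nat -> exists c, forall i, g i < c.
Proof.
move=> cI; apply: contrapT => /forallNP nc.
apply: (@next_cardinal_not_injects omega); apply/card_leTT_injects.
have nomax := infinite_cardinal_unbounded omega1_infinite_cardinal.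
have /choice[s sP] := nomax.
apply: (@card_le_trans _ _ _ (\bigcup_(i in [set: I]) [set c | c < s (g i)])).
  apply: subset_card_le => c _; have /existsNP[i /negP] := nc c.
  by rewrite -leNgt => cg; exists i => //=; exact: le_lt_trans (sP _).
apply: bigcup_countable; first exact/card_leTT_injects.
by move=> i _; exact: (proj2 (next_cardinalP omega)).
Qed.

Lemma harmonic_le (R : realType) (x y : R) : (0 <= x)%R -> (0 < y)%R ->
  exists n : nat, (x * n.+1%:R^-1 <= y)%R.
Proof.
move=> x0 y0; have xy0 : (0 <= x / y)%R by rewrite divr_ge0 // ltW.
exists (Num.bound (x / y)); rewrite ler_pdivrMr ?ltr0n //.
have := archi_boundP xy0; rewrite ltr_pdivrMr // => /ltW/le_trans; apply.
by rewrite mulrC ler_pM2l // ler_nat.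
Qed.

Section omega1_long_line.
Context (R : realType) (D W : ord) (u : ord_mul omega1 W -> D)
  (v : D -> ord_mul omega1 W).
Hypothesis u_mono : {mono u : x y / x <= y}.
Hypothesis uK : cancel u v.
Hypothesis vK : cancel v u.
Local Notation L := (closed_long_line R D).

(** The isomorphism [u] cuts the line into blocks of length [omega1], indexed by
    [W]. *)
Definition pt (w : W) (c : omega1) (t : unit_co R) : L := line_pt (u (w, c)) t.

Lemma pt_lt w c t w' c' t' : (pt w c t < pt w' c' t') =
  (w < w') || ((w == w') && ((c < c') || ((c == c') && (t < t')))).
Proof.
rewrite line_pt_lt (leW_mono u_mono) mul_ltE /= (inj_eq (can_inj uK)).
by rewrite xpair_eqE; case: ltgtP; case: (ltgtP c c').
Qed.

Lemma pt_le w c t w' c' t' : (pt w c t <= pt w' c' t') =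
  (w < w') || ((w == w') && ((c < c') || ((c == c') && (t <= t')))).
Proof.
rewrite line_pt_le (leW_mono u_mono) mul_ltE /= (inj_eq (can_inj uK)).
by rewrite xpair_eqE; case: ltgtP; case: (ltgtP c c').
Qed.

Lemma ptP (x : L) : x = line_end R D \/ exists w c t, x = pt w c t.
Proof.
have [->|[a [t ->]]] := line_ptP x; [by left|right].
by exists (v a).1, (v a).2, t; rewrite /pt -surjective_pairing vK.
Qed.

Lemma omega1_least : exists c0 : omega1, forall c, c0 <= c.
Proof.
have [c _] := inhabited_infinite (proj2 omega1_infinite_cardinal).
have [|c0 _ c0min] := @ord_least omega1 setT; first by exists c.
by exists c0 => c'; exact: c0min.
Qed.

Definition c0 : omega1 := sval (cid omega1_least).

Lemma c0_le c : c0 <= c.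
Proof. exact: (svalP (cid omega1_least)). Qed.

Lemma zero_itv : (0 <= (0 : R) < 1)%R.
Proof. by rewrite lexx ltr01. Qed.

Lemma half_itv : (0 <= (2^-1 : R) < 1)%R.
Proof. by apply/andP; split; lra. Qed.

Definition t0 : unit_co R := unit_co_of zero_itv.
Definition half : unit_co R := unit_co_of half_itv.

Lemma t0_le (t : unit_co R) : t0 <= t.
Proof. by rewrite unit_co_le frac_of; have [] := unit_co_bound t. Qed.

Lemma omega1_nomax (c : omega1) : exists c', c < c'.
Proof. exact: (infinite_cardinal_unbounded omega1_infinite_cardinal). Qed.

Lemma omega1_enum (c : omega1) : exists e : omega1 -> nat,
  forall a b, a <= c -> b <= c -> e a = e b -> a = b.
Proof.
have [c' cc'] := omega1_nomax c.
have [f fi] : injects (segment c') nat := next_cardinal_segment c'.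
have /choice[e eP] : forall a, exists n, forall ac' : a < c', n = f (exist _ a ac').
  move=> a; have [ac'|nac'] := pselect (a < c'); last by exists 0%N.
  by exists (f (exist _ a ac')) => h; congr (f (exist _ a _)); exact: bool_irrelevance.
exists e => a b ac bc; rewrite (eP a (le_lt_trans ac cc')) (eP b (le_lt_trans bc cc')).
by move=> /fi[].
Qed.

(** An initial part of a block lies over a countable ordinal, so [coord] makes it
    a real interval. *)
Lemma block_move w c t : pt w c0 t0 < pt w c t ->
  exists f g : L -> L, [/\ {homo f : x y / x < y}, {homo g : x y / x < y},
    cancel f g, cancel g f & f (pt w c t) = pt w c0 half].
Proof.
move=> lt_ct; have [e e_inj] := omega1_enum c.
pose phi (x : L) : R := if x is Some (a, t) then coord e (v a).2 t else 0%R.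
have phiE w' c' t' : phi (pt w' c' t') = coord e c' t' by rewrite /phi /= uK.
pose B : set L := [set x | exists c' t', c' <= c /\ x = pt w c' t'].
have phi_lt x y : B x -> B y -> x < y -> (phi x < phi y)%R.
  move=> [c1 [t1 [c1c ->]]] [c2 [t2 [c2c ->]]].
  by move=> H; rewrite !phiE; apply: (coord_lt e_inj c2c); move: H; rewrite pt_lt ltxx eqxx.
have B0 : B (pt w c0 t0) by exists c0, t0; rewrite c0_le.
have Bh : B (pt w c0 half) by exists c0, half; rewrite c0_le.
have Bct : B (pt w c t) by exists c, t.
have phi_itv x : B x -> (0 <= phi x < coord_end R c e)%R.
  by move=> [c1 [t1 [c1c ->]]]; rewrite phiE; exact: coord_itv.
have phi_neq0 x : B x -> pt w c0 t0 < x -> phi x != 0%R.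
  move=> Bx /(phi_lt _ _ B0 Bx) H; rewrite gt_eqF //.
  by apply: le_lt_trans H; have /andP[] := phi_itv _ B0.
apply: (@block_homogeneous _ L R B phi (coord_end R c e)) => //.
- move=> x y z [c1 [t1 [c1c ->]]] [c2 [t2 [c2c ->]]].
  have [->|[w' [c' [t' ->]]]] := ptP y; first by rewrite line_end_lt.
  rewrite !pt_lt; case: (ltgtP w w') => //= <- _ H2; exists c', t'; split=> //.
  by apply: le_trans c2c; case: ltgtP H2.
- move=> s /coord_surj-/(_ e_inj)[c' [t' [c'c <-]]].
  by exists (pt w c' t'); [exists c', t'|rewrite phiE].
- exact: phi_neq0.
- apply: phi_neq0 => //; rewrite pt_lt ltxx eqxx /= ltxx eqxx /=.
  by rewrite unit_co_lt !frac_of invr_gt0.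
Qed.

(** If [t > 0], a sequence in the unit interval of [pt w c t] is cofinal; if
    [t = 0], countably many unit intervals of the block precede the point. *)
Lemma cofinal_left w c t : pt w c0 t0 < pt w c t ->
  exists (I : Type) (Q : I -> L), [/\ injects I nat, forall i, Q i < pt w c t &
    forall y, y < pt w c t -> exists i, y <= Q i].
Proof.
rewrite pt_lt ltxx eqxx /= => lt_ct.
have [tt0|tt0] := eqVneq t t0.
  have s01 (n : nat) : (0 <= (1 : R) - n.+1%:R^-1 < 1)%R.
    have n0 : (0 < n.+1%:R^-1 :> R)%R by rewrite invr_gt0.
    have n1 : (n.+1%:R^-1 <= 1 :> R)%R by rewrite invf_le1 // ler1n.
    by move: n0 n1; set z := (_^-1)%R => n0 n1; apply/andP; split; lra.
  exists (segment c * nat)%type, (fun i => pt w (val i.1) (unit_co_of (s01 i.2))).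
  split.
  - apply: injects_trans (injects_square (injects_refl nat)).
    by apply: injects_prod (injects_refl _); exact: next_cardinal_segment.
  - move=> [c' n] /=; rewrite pt_lt ltxx eqxx /=; apply/orP; left.
    exact: (valP c').
  - move=> y yx; have [yE|[w' [c' [t' yE]]]] := ptP y.
      by move: yx; rewrite yE line_end_lt.
    move: yx; rewrite yE pt_lt tt0 [t' < t0]ltNge t0_le andbF orbF.
    have c0c : c0 < c by move: lt_ct; rewrite tt0 ltxx andbF orbF.
    case: (ltgtP w' w) => //= [ww' _|-> c'c].
      by exists (exist _ c0 c0c : segment c, 0%N); rewrite pt_le ww'.
    have [_ t'1] := unit_co_bound t'.
    have [|n] := @harmonic_le R 1%R (1 - frac t')%R ler01; first by rewrite subr_gt0.
    rewrite mul1r => nP; exists (exist _ c' c'c : segment c, n).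
    rewrite pt_le ltxx eqxx /= ltxx eqxx /= unit_co_le frac_of.
    by rewrite lerBrDr -lerBrDl.
have t_gt0 : (0 < frac t)%R.
  by have : t0 < t by rewrite lt_neqAle eq_sym tt0 t0_le.
have s01 (n : nat) : (0 <= frac t * (1 - n.+1%:R^-1) < 1)%R.
  have [s0 s1] := unit_co_bound t.
  have n0 : (0 < n.+1%:R^-1 :> R)%R by rewrite invr_gt0.
  have n1 : (n.+1%:R^-1 <= 1 :> R)%R by rewrite invf_le1 // ler1n.
  apply/andP; split; first by rewrite mulr_ge0 // subr_ge0.
  by apply: le_lt_trans s1; rewrite ler_piMr // gerBl ltW.
exists nat, (fun n => pt w c (unit_co_of (s01 n))); split.
- exact: injects_refl.
- move=> n; rewrite pt_lt ltxx eqxx /= ltxx eqxx /= unit_co_lt frac_of.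
  by rewrite gtr_pMr // ltrBlDr ltrDl invr_gt0.
- move=> y yx; have [yE|[w' [c' [t' yE]]]] := ptP y.
    by move: yx; rewrite yE line_end_lt.
  move: yx; rewrite {}yE pt_lt.
  have [t't|tt'] := ltP t' t.
    have [|n nP] := @harmonic_le R _ (frac t - frac t')%R (ltW t_gt0).
      by rewrite subr_gt0 -unit_co_lt.
    move=> H; exists n; rewrite pt_le; case: (ltgtP w' w) H => //= _.
    case: (ltgtP c' c) => //= _ _; rewrite unit_co_le frac_of mulrBr mulr1.
    by rewrite lerBrDr -lerBrDl.
  rewrite andbF orbF => H; exists 0%N; rewrite pt_le.
  by case: (ltgtP w' w) H => //= _ ->.
Qed.

Lemma cofinal_right w c t : exists Q : nat -> L, (forall n, pt w c t < Q n) /\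
  forall y, pt w c t < y -> exists n, Q n <= y.
Proof.
have [s0 s1] := unit_co_bound t.
have s01 (n : nat) : (0 <= frac t + (1 - frac t) / 2 * n.+1%:R^-1 < 1)%R.
  have n0 : (0 < n.+1%:R^-1 :> R)%R by rewrite invr_gt0.
  have n1 : (n.+1%:R^-1 <= 1 :> R)%R by rewrite invf_le1 // ler1n.
  have H : (0 <= (1 - frac t) / 2 * n.+1%:R^-1)%R.
    by rewrite mulr_ge0 ?(ltW n0) //; lra.
  have H' : ((1 - frac t) / 2 * n.+1%:R^-1 <= (1 - frac t) / 2)%R.
    by rewrite ler_piMr //; lra.
  by move: H H'; set z := (_ * _)%R => H H'; apply/andP; split; lra.
exists (fun n => pt w c (unit_co_of (s01 n))); split.
  move=> n; rewrite pt_lt ltxx eqxx /= ltxx eqxx /= unit_co_lt frac_of.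
  by rewrite ltrDl mulr_gt0 ?invr_gt0 //; lra.
move=> y; have [->|[w' [c' [t' ->]]]] := ptP y.
  by exists 0%N; exact: line_end_max.
rewrite pt_lt; have [tt'|t't] := ltP t t'.
  have [||n nP] := @harmonic_le R ((1 - frac t) / 2)%R (frac t' - frac t)%R.
  - lra.
  - by rewrite subr_gt0 -unit_co_lt.
  move=> H; exists n; rewrite pt_le; case: (ltgtP w w') H => //= _.
  case: (ltgtP c c') => //= _ _; rewrite unit_co_le frac_of.
  by rewrite -lerBrDl.
rewrite andbF orbF => H; exists 0%N; rewrite pt_le.
by case: (ltgtP w w') H => //= _ ->.
Qed.

Section lower_bound.
Context (w0 : W).
Hypothesis w0_le : forall w, w0 <= w.
Context (p : nat -> nat).

Definition line_start : L := pt w0 c0 t0.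

Lemma line_start_min (x : L) : line_start <= x.
Proof.
have [->|[w [c [t ->]]]] := ptP x; first exact: line_end_max.
rewrite pt_le; move: (w0_le w); rewrite le_eqVlt => /predU1P[<-|-> //].
rewrite eqxx ltxx /=; move: (c0_le c); rewrite le_eqVlt => /predU1P[<-|-> //].
by rewrite eqxx ltxx t0_le.
Qed.

Lemma line_start_end : line_start != line_end R D.
Proof. by []. Qed.

(** Assume such an [h]. Near [pt wa c0 t0] it induces a monotone map [f] of the
    line. If [f] increases, the suprema of the images of the blocks are again
    ends of blocks, having uncountable cofinality, which gives an increasing map
    that the hypothesis on [wa] and [wb] excludes. If [f] decreases, the infimum
    of the image of a block has uncountable coinitiality, which is impossible. *)
Lemma no_homeomorphism wa wb :
  w0 < wa -> w0 < wb ->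
  (forall b, b < wa -> forall f, (forall s, b < s < wa -> f s <= wb) ->
    ~ (forall s t, b < s -> s < t -> t < wa -> f s < f t)) ->
  forall i (ci : compatible (p := p) i) j (cj : compatible (p := p) j)
    (h : solenoid L p -> solenoid L p), Defs.homeomorphism h ->
  h (thread ci (pt wa c0 t0)) <> thread cj (pt wb c0 t0).
Proof.
move=> w0a w0b NE i ci j cj h [hc [h' [_ hh' _]]] hab.
have inner w : w0 < w -> line_start < pt w c0 t0 < line_end R D.
  by move=> w0w; rewrite pt_lt w0w.
have [q [f [qa fa f_mono]]] := thread_local_map line_start_min
  (@line_end_max R D) line_start_end (@line_sup R D) (@line_dense R D) hc
  (can_inj hh') (inner _ w0a) (inner _ w0b) hab.
have [qE|[p0 [cq [tq qE]]]] := ptP q; first by move: qa; rewrite qE line_end_lt.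
have p0a : p0 < wa.
  move: qa; rewrite qE pt_lt => /orP[//|/andP[_]].
  by rewrite [cq < c0]ltNge c0_le [tq < t0]ltNge t0_le andbF.
have qs s c : p0 < s -> q <= pt s c t0 by move=> p0s; rewrite qE pt_le p0s.
have sa s c : s < wa -> pt s c t0 < pt wa c0 t0 by move=> sw; rewrite pt_lt sw.
have ltc s c c' : c < c' -> pt s c t0 < pt s c' t0.
  by move=> cc'; rewrite pt_lt eqxx cc' orbT.
case: f_mono => f_mono.
  have /choice[F FP] : forall s, exists r, p0 < s < wa ->
      (forall c, f (pt s c t0) <= pt r c0 t0) /\
      forall x, (forall c, f (pt s c t0) <= x) -> pt r c0 t0 <= x.
    move=> s; have [/andP[p0s swa]|ns] := pselect (p0 < s < wa); last by exists w0.
    have yh c c' : c < c' -> f (pt s c t0) < f (pt s c' t0).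
      move=> cc'; apply: f_mono; [exact: qs|exact: ltc|exact/ltW/sa].
    have [z [zub zlub]] := line_sup [set f (pt s c t0) | c in [set: omega1]].
    have zb : z <= pt wb c0 t0.
      apply: zlub => _ [c _ <-]; rewrite -fa; apply: ltW.
      by apply: f_mono; [exact: qs|exact: sa|exact: lexx].
    have yz c : f (pt s c t0) <= z by apply: zub; exists c.
    have [zE|[r [c [t zE]]]] := ptP z.
      by move: zb; rewrite zE leNgt line_pt_lt_end.
    (* If [z] were an inner point of its block, a countable family [Q] would be
       cofinal below it, and so would be the images of countably many points of
       the block [s]. *)
    suff zr : z <= pt r c0 t0.
      exists r => _; split=> [c'|x xub]; first exact: le_trans zr.
      apply: (@le_trans _ _ z); last by apply: zlub => _ [c' _ <-].
      rewrite zE pt_le eqxx ltxx /=.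
      move: (c0_le c); rewrite le_eqVlt => /predU1P[<-|-> //].
      by rewrite eqxx ltxx t0_le.
    rewrite leNgt; apply/negP; rewrite zE => /cofinal_left[I [Q [cI Qz Qcof]]].
    have /choice[g gP] : forall i, exists c, Q i < f (pt s c t0).
      move=> k; apply: contrapT => /forallNP nQ; have := Qz k; rewrite -zE ltNge.
      by move/negP; apply; apply: zlub => _ [c' _ <-]; rewrite leNgt; apply/negP.
    have [c' c'P] := omega1_bounded g cI; have [c'' cc''] := omega1_nomax c'.
    have [k] : exists k, f (pt s c' t0) <= Q k.
      by apply: Qcof; rewrite -zE; apply: lt_le_trans (yz c''); exact: yh.
    by rewrite leNgt (lt_trans (gP k)) // yh.
  apply: (NE _ p0a F) => [s sP|s t p0s st ta].
    have [_ /(_ (pt wb c0 t0))] := FP s sP; have /andP[p0s swa] := sP.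
    have H c : f (pt s c t0) <= pt wb c0 t0.
      rewrite -fa; apply/ltW/f_mono; [exact: qs|exact: sa|exact: lexx].
    by move=> /(_ H); rewrite pt_le => /orP[/ltW //|/andP[/eqP -> _]].
  have [_ sl] : _ /\ _ := FP s (introT andP (conj p0s (lt_trans st ta))).
  have p0t := lt_trans p0s st.
  have [tu _] : _ /\ _ := FP t (introT andP (conj p0t ta)).
  have [c1 c01] := omega1_nomax c0.
  have : pt (F s) c0 t0 < pt (F t) c0 t0.
    apply: (@le_lt_trans _ _ (f (pt t c0 t0))).
      apply: sl => c; apply/ltW/f_mono; [exact: qs| |exact/ltW/sa].
      by rewrite pt_lt st.
    apply: lt_le_trans (tu c1).
    by apply: f_mono; [exact: qs|exact: ltc|exact/ltW/sa].
  by rewrite pt_lt !ltxx !andbF orbF.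
have [s /andP[p0s swa]] : exists s, p0 < s < wa.
  apply: contrapT => /forallNP ns; apply: (NE _ p0a id) => [s /ns//|s t p0s st ta].
  exact: st.
have yh c c' : c < c' -> f (pt s c' t0) < f (pt s c t0).
  move=> cc'; apply: f_mono; [exact: qs|exact: ltc|exact/ltW/sa].
have [z [zlb zglb]] := line_inf [set f (pt s c t0) | c in [set: omega1]].
have yz c : z <= f (pt s c t0) by apply: zlb; exists c.
have [c1 c01] := omega1_nomax c0.
have [zE|[r [c [t zE]]]] := ptP z.
  by move: (lt_le_trans (yh _ _ c01) (line_end_max _)); rewrite ltNge -zE yz.
have [Q [zQ Qcof]] := cofinal_right r c t.
have /choice[g gP] : forall n, exists c, f (pt s c t0) < Q n.
  move=> n; apply: contrapT => /forallNP nQ; have := zQ n; rewrite -zE ltNge.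
  by move/negP; apply; apply: zglb => _ [c' _ <-]; rewrite leNgt; apply/negP.
have [c' c'P] := omega1_bounded g (injects_refl nat).
have [c'' cc''] := omega1_nomax c'.
have [n] : exists n, Q n <= f (pt s c' t0).
  by apply: Qcof; rewrite -zE; apply: le_lt_trans (yz c'') _; exact: yh.
by rewrite leNgt (lt_trans _ (gP n)) // yh.
Qed.
End lower_bound.
End omega1_long_line.

(** * Counting the orbits *)

Lemma homeomorphism_id (X : topologicalType) : Defs.homeomorphism (@id X).
Proof. by split; [move=> x; exact: cvg_id|exists id; split=> // x; exact: cvg_id]. Qed.

Lemma homeomorphism_comp (X : topologicalType) (f g : X -> X) :
  Defs.homeomorphism f -> Defs.homeomorphism g -> Defs.homeomorphism (g \o f).
Proof.
move=> [fc [f' [f'c ff' f'f]]] [gc [g' [g'c gg' g'g]]]; split.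
  by move=> x; apply: continuous_comp; [exact: fc|exact: gc].
exists (f' \o g'); split.
- by move=> x; apply: continuous_comp; [exact: g'c|exact: f'c].
- by move=> x /=; rewrite gg' ff'.
- by move=> x /=; rewrite f'f g'g.
Qed.

Lemma homeo_orbit_eq (X : topologicalType) (x y : X) :
  homeo_orbit x y -> homeo_orbit x = homeo_orbit y.
Proof.
move=> [f fh fx]; have [fc [f' [f'c ff' f'f]]] := fh.
have f'h : Defs.homeomorphism f' by split=> //; exists f.
apply/seteqP; split=> z [g gh <-].
  exists (g \o f'); first exact: homeomorphism_comp.
  by rewrite /= -fx ff'.
exists (g \o f); first exact: homeomorphism_comp.
by rewrite /= fx.
Qed.

Lemma homeo_orbit_refl (X : topologicalType) (x : X) : homeo_orbit x x.
Proof. by exists id => //; exact: homeomorphism_id. Qed.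

(** The orbits are those of the points over the first points of the blocks of
    length [omega1] and over the middle of the first unit interval of each block. *)
Theorem frac_homogeneous_omega1_mul (R : realType) (p : nat -> nat) (D W K : ord) :
  (forall n, (0 < p n)%N) -> isomorphic D (ord_mul omega1 W) ->
  infinite_set [set: K] -> injects W K ->
  (exists w : K -> W, [/\ {homo w : x y / x < y}, forall xi, exists b, b < w xi &
    forall xi zeta, xi < zeta -> forall b, b < w zeta -> forall f,
      (forall s, b < s < w zeta -> f s <= w xi) ->
      ~ (forall s t, b < s -> s < t -> t < w zeta -> f s < f t)]) ->
  frac_homogeneous K (solenoid (closed_long_line R D) p).
Proof.
move=> p_gt0 [DW WD] infK WK [w [wh w_pos w_ne]].
have [v [u [v_mono vK uK]]] := embeds_anti DW WD.
have u_mono : {mono u : x y / x <= y} by move=> x y; rewrite -v_mono !uK.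
have [x0 _] := inhabited_infinite infK.
have [|w0 _ w0min] := @ord_least W setT; first by exists (w x0).
have w0_le x : w0 <= x by exact: w0min.
have w0_lt xi : w0 < w xi by have [b /(le_lt_trans (w0_le b))] := w_pos xi.
pose top := line_end R D; pose bot := line_start R u w0.
have bot_min x : bot <= x := line_start_min u_mono uK vK w0_le x.
have top_max x : x <= top := line_end_max x.
have bot_top : bot != top by [].
pose base x := thread (@zero_compatible p p_gt0) x : solenoid (closed_long_line R D) p.
apply/card_eqPle; split.
  pose phi (z : W * bool) := homeo_orbit (base (pt u z.1 c0 (if z.2 then t0 R else half R))).
  apply: (@card_le_trans _ _ _ (phi @` setT)); last first.
    apply: card_le_trans (card_image_le phi setT) _; apply/card_leTT_injects.
    move/injects_infinite: infK => infK.
    apply: injects_trans (injects_square infK).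
    apply: injects_prod WK (injects_trans _ infK).
    by exists nat_of_bool => -[] [].
  apply: subset_card_le => _ [s _ <-].
  have [i [ci [x [xt ->]]]] := threadP bot_min top_max bot_top s.
  have [xE|[a [c [t xE]]]] := ptP vK x; first by rewrite xE eqxx in xt.
  have [f [g [fh gh fg gf [b fx]]]] : exists f g, [/\ {homo f : x y / x < y},
      {homo g : x y / x < y}, cancel f g, cancel g f &
      exists b : bool, f x = pt u a c0 (if b then t0 R else half R)].
    rewrite xE; have [/andP[/eqP -> /eqP ->]|ct] := boolP ((c == c0) && (t == t0 R)).
      by exists id, id; split=> //; exists true.
    have [|f [g [fh gh fg gf fx]]] := block_move u_mono uK vK (w := a) (c := c) (t := t).
      rewrite (pt_lt u_mono uK) ltxx eqxx /=; move: ct.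
      have := c0_le c; rewrite le_eqVlt => /predU1P[<-|-> //].
      by rewrite eqxx ltxx /= lt_neqAle t0_le andbT eq_sym.
    by exists f, g; split=> //; exists false.
  exists (a, b) => //; rewrite /phi /= -fx.
  have fm := le_mono fh; have gm := le_mono gh.
  have ft : f top = top by apply/eqP; rewrite eq_le top_max -gm fg top_max.
  have fb : f bot = bot by apply/eqP; rewrite eq_le bot_min -gm fg bot_min.
  apply/esym/homeo_orbit_eq.
  apply: (thread_orbit bot_min top_max bot_top p_gt0 ci x ft fb _ _ fg gf).
  - exact: order_iso_continuous fh gh fg gf.
  - exact: order_iso_continuous gh fh gf fg.
pose psi xi := homeo_orbit (base (pt u (w xi) c0 (t0 R))).
have psi_lt xi zeta : xi < zeta -> psi xi <> psi zeta.
  move=> xz E.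
  have [h hh hab] : psi zeta (base (pt u (w xi) c0 (t0 R))).
    by rewrite -E; exact: homeo_orbit_refl.
  by apply: (no_homeomorphism _ _ _ _ _ _ _ hh hab) => //; exact: w_ne.
have psi_inj : injective psi.
  move=> xi zeta E; case: (ltgtP xi zeta) => // /psi_lt; first by rewrite E.
  by move=> H; case: H.
apply: (@card_le_trans _ _ _ (psi @` [set: K])).
  have /card_eqPle[//] : [set: K] #= psi @` [set: K].
  by rewrite card_eq_sym; apply: inj_card_eq => x y _ _; exact: psi_inj.
by apply: subset_card_le => _ [xi _ <-]; exists (base (pt u (w xi) c0 (t0 R))).
Qed.

Theorem theorem3p3 (R : realType) (p : nat -> nat)
  (hp : forall n, (1 < p n)%N) :
  (forall kappa : ord, is_infinite_cardinal kappa ->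
     frac_homogeneous kappa
       (solenoid (closed_long_line R (ord_mul omega1 (ord_exp omega kappa))) p)) /\
  frac_homogeneous omega
    (solenoid (closed_long_line R (ord_mul omega1 (ord_exp omega omega))) p) /\
  frac_homogeneous omega1
    (solenoid (closed_long_line R (ord_exp omega1 (fin_ord 2))) p) /\
  (forall kappa : ord, is_cardinal kappa -> ord_le omega2 kappa ->
     frac_homogeneous kappa (solenoid (closed_long_line R kappa) p)).
Proof.
have p_gt0 n : (0 < p n)%N by exact: ltnW (hp n).
have main D K : is_infinite_cardinal K ->
    isomorphic D (ord_mul omega1 (ord_exp omega K)) ->
    frac_homogeneous K (solenoid (closed_long_line R D) p).
  move=> cK iso; apply: (frac_homogeneous_omega1_mul _ p_gt0 iso).
  - exact: (proj2 cK).
  - exact: injects_ord_exp_omega.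
  - exact/power_points/infinite_cardinal_unbounded.
have iso_refl A : isomorphic A A by split; exact: embeds_refl.
split; first by move=> K cK; exact: main.
split; first exact: main omega_infinite_cardinal _.
split; first exact: main omega1_infinite_cardinal omega1_square_isomorphic.
move=> K cK o2K; apply: main; last exact: cardinal_isomorphic.
by split=> //; exact: infinite_ge_omega2.
Qed.
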